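(* There exists an absolute constant $C\ge1$ such that the following holds. Let $s\le d$ be positive integers with $s^2\ge Cd$, let $0<M\le\sqrt{\log(s^2/d)}$, and put $$K=\frac{e^2\log(s^2/d)}{\log\big(e\log(s^2/d)/M^2\big)}.$$ Let $F:\mathbb R\to\mathbb R$ be continuous on $[-\sqrt{\log(s^2/d)},\sqrt{\log(s^2/d)}]$ and assume that, for some constants $C_1'',C_2''>0$ and $\epsilon_1,\epsilon_2\ge 0$ with $2\epsilon_1+2\epsilon_2<1$, $$\|F-F(0)\|_{\infty,[-M,M]}\le C_1''\Big(\frac{s^2}{d}\Big)^{\epsilon_1},\qquad \delta_{K,M}^{-1}\le C_2''\Big(\frac{s^2}{d}\Big)^{\epsilon_2}.$$ Then, with $\mathbf F(\theta)=\sum_{i=1}^dF(\theta_i)$, $$\inf_{\hat{\mathbf F}}\sup_{\theta\in\Theta_{s,M}}\mathbf E_\theta\big(\hat{\mathbf F}-\mathbf F(\theta)\big)^2\ge C_3''\,s^2\,\delta_{K,M}^2$$ for some constant $C_3''>0$ depending only on $C_1''$ and $C_2''$.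
   Context: $\Theta_{s,M}=\{\theta\in\mathbb R^d:\|\theta\|_0\le s,\ \|\theta\|_\infty\le M\}$, where $\|\theta\|_0$ is the number of nonzero coordinates of $\theta$. The observation is $y\sim\mathcal N(\theta,I_d)$, $\mathbf E_\theta$ is the corresponding expectation, and the infimum is over all estimators $\hat{\mathbf F}$, i.e. real-valued measurable functions of $y$. For real $K\ge0$, $\mathcal P_K$ is the set of real polynomials of degree at most $K$; $\|g\|_{\infty,[-M,M]}=\sup_{|x|\le M}|g(x)|$; $\delta_{K,M}=\min_{P\in\mathcal P_K}\|F-P\|_{\infty,[-M,M]}$. *)

(* Defs.v *)
(* MathComp-Analysis; the reals are an arbitrary R : realType. *)
From HB Require Import structures.
From mathcomp Require Import all_boot all_order all_algebra.
From mathcomp Require Import all_classical all_reals all_analysis.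

Set Implicit Arguments.
Unset Strict Implicit.
Unset Printing Implicit Defensive.

Import Order.TTheory GRing.Theory Num.Theory.
Import numFieldNormedType.Exports.

Local Open Scope classical_set_scope.
Local Open Scope ring_scope.

Section product_probability.
Context d (T : measurableType d) (R : realType).

Definition tuple_cons n (p : T * n.-tuple T) : n.+1.-tuple T :=
  [tuple of p.1 :: p.2].

Lemma measurable_tuple_cons n : measurable_fun setT (@tuple_cons n).
Proof. by apply: measurable_cons. Qed.

HB.instance Definition _ n :=
  isMeasurableFun.Build _ _ _ _ (@tuple_cons n) (@measurable_tuple_cons n).

(* The law of n independent variables X_i ~ P i, built one coordinate at a
   time from the binary product measure; see prod_probE. *)
Fixpoint prod_prob n : ('I_n -> probability T R) -> probability (n.-tuple T) R :=
  if n is m.+1 then fun P =>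
    distribution (P ord0 \x prod_prob (fun i => P (lift ord0 i)))%E (@tuple_cons m)
  else fun=> \d_([tuple] : 0.-tuple T).

Lemma prod_probE n (P : 'I_n -> probability T R) (A : 'I_n -> set T) :
  (forall i, measurable (A i)) ->
  prod_prob P [set y | forall i, A i (tnth y i)] = (\prod_(i < n) P i (A i))%E.
Proof.
elim: n P A => [|n IH] P A mA.
  by rewrite big_ord0 /= diracE mem_set// => -[].
rewrite big_ord_recl -IH//= /distribution /pushforward.
rewrite -product_measure1E//; last first.
  rewrite [X in measurable X](_ : _ = \bigcap_(i in [set: 'I_n])
      ((@tnth _ T ^~ i) @^-1` A (lift ord0 i))).
    apply: fin_bigcap_measurable => // i _; rewrite -[X in measurable X]setTI.
    exact: measurable_tnth.
  by apply/seteqP; split => [y /= + i _|y /= + i]; apply.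
congr (product_measure1 _ _ _); apply/seteqP; split => -[x y] /=.
  move=> Ay; split; first by have := Ay ord0.
  by move=> i; have := Ay (lift ord0 i); rewrite tnthS.
move=> [/= A0 Ay] i; case: (unliftP ord0 i) => [j|] -> //.
by rewrite tnthS.
Qed.

End product_probability.

Section gaussian_sequence_model.
Context (R : realType).

(* N(theta, I_d): independent coordinates with laws N(theta_i, 1), where
   normal_prob m s has standard deviation s.  The sample space R^d is spelled
   d.-tuple (measurableTypeR R), measurableTypeR R being R with its Borel
   sigma-algebra in the form over which normal_prob is defined; tuples carry
   the product sigma-algebra. *)
Definition normal_law d (theta : d.-tuple R) :
    probability (d.-tuple (measurableTypeR R)) R :=
  prod_prob (fun i => normal_prob (tnth theta i) 1).

Definition norm0 d (theta : d.-tuple R) : nat := #|[pred i | tnth theta i != 0]|.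

Definition norm_infty d (theta : d.-tuple R) : R :=
  \big[Num.max/0]_(i < d) `|tnth theta i|.

Definition Theta d (s : nat) (M : R) : set (d.-tuple R) :=
  [set theta | (norm0 theta <= s)%N /\ norm_infty theta <= M].

Definition additive_functional (F : R -> R) d (theta : d.-tuple R) : R :=
  \sum_(i < d) F (tnth theta i).

Local Open Scope ereal_scope.

Definition mse d (Phi : d.-tuple R -> R) (est : d.-tuple (measurableTypeR R) -> R)
    (theta : d.-tuple R) : \bar R :=
  'E_(normal_law theta)[fun y => ((est y - Phi theta) ^+ 2)%R].

Definition minimax_risk d (Th : set (d.-tuple R)) (Phi : d.-tuple R -> R) :
    \bar R :=
  ereal_inf [set ereal_sup [set mse Phi est theta | theta in Th]
            | est in [set: {mfun d.-tuple (measurableTypeR R) >-> R}]].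

End gaussian_sequence_model.

Section polynomial_approximation.
Context (R : realType).

Definition sup_norm (M : R) (g : R -> R) : \bar R :=
  ereal_sup [set `|g x|%:E | x in [set x | `|x| <= M]].

(* size p = deg p + 1 for p != 0; the zero polynomial has (size 0).-1 = 0, so
   it belongs to polys K for every K >= 0. *)
Definition polys (K : R) : set {poly R} := [set p | (size p).-1%:R <= K].

(* The minimum over polys K is attained for F bounded on [-M, M], M > 0, so
   this infimum is that minimum. *)
Definition best_approx (F : R -> R) (K M : R) : \bar R :=
  ereal_inf [set sup_norm M (fun x => F x - p.[x]) | p in polys K].

End polynomial_approximation.

(* Main.v *)
Require Import Defs.
From mathcomp Require Import all_boot all_order all_algebra.
From mathcomp Require Import all_classical all_reals all_analysis.
From mathcomp Require Import measurable_realfun ring lra.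

(* Duality for uniform approximation by polynomials gives two finitely supported
   probabilities p0 and p1 on [-M, M] with the same moments up to degree K and with
   integrals of F at least delta apart.  Group coordinates into s disjoint
   blocks of size d %/ s and, independently in each block, leave the block empty with
   probability 1/2 and otherwise put a value drawn from p0 (resp. p1) at a uniformly
   chosen place.  These two priors are s-sparse surely, the prior means of the functional
   are at least s delta / 2 apart, and with r = s^2 / d the choice of K makes the
   chi-square divergence between the two laws of the observation at most 8 / r^2.

   Under the hypothesis 2 eps1 + 2 eps2 < 1 alone, the fluctuation of the functional
   under each prior may be as large as the separation, so a test between the two priors
   does not suffice.  The sum of the two Bayes risks is instead bounded below by a
   constrained risk inequality, in which that fluctuation only enters multiplied by the
   small divergence.  This settles the case where s exceeds a constant depending on C1
   and C2; otherwise r <= s is bounded and two points at distance at most M suffice. *)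

Set Implicit Arguments.
Unset Strict Implicit.
Unset Printing Implicit Defensive.

Import Order.TTheory GRing.Theory Num.Theory.
Import numFieldNormedType.Exports.

Local Open Scope classical_set_scope.
Local Open Scope ring_scope.

(** * Gaussian likelihood ratios *)

Section gaussian_likelihood.
Context {R : realType}.
Local Open Scope ereal_scope.

(** The Radon-Nikodym derivative of [normal_prob m s] and the function [normal_pdf m s] have the
    same integral over every measurable set, hence agree almost everywhere. *)
Lemma ge0_integral_normal_prob (m s : R) (f : measurableTypeR R -> \bar R) :
  measurable_fun setT f -> (forall x, 0 <= f x) ->
  \int[normal_prob m s]_x f x =
  \int[lebesgue_measure]_x (f x * (normal_pdf m s x)%:E).
Proof.
move=> mf f0.
have dom := normal_prob_dominates m s.
rewrite -(Radon_Nikodym_SigmaFinite.change_of_variables dom f0 measurableT mf).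
have mRN := measurable_int _ (Radon_Nikodym_SigmaFinite.f_integrable dom).
have mpdf : measurable_fun setT (fun x => (normal_pdf m s x)%:E).
  by apply/measurable_EFinP; exact: measurable_normal_pdf.
apply: ge0_ae_eq_integral => //.
- exact: emeasurable_funM.
- exact: emeasurable_funM.
- by move=> x _; rewrite mule_ge0// Radon_Nikodym_SigmaFinite.f_ge0.
- by move=> x _; rewrite mule_ge0// lee_fin normal_pdf_ge0.
- apply: ae_eqe_mul2l; apply: integral_ae_eq => //.
    exact: Radon_Nikodym_SigmaFinite.f_integrable.
  by move=> E _ mE; rewrite -Radon_Nikodym_SigmaFinite.f_integral.
Qed.

(* The density of N(t, 1) with respect to N(0, 1). *)
Definition lik1 (t x : R) : R := expR (t * x - t ^+ 2 / 2).

Lemma measurable_lik1 t : measurable_fun [set: measurableTypeR R] (lik1 t).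
Proof.
by apply: measurableT_comp => //; apply: measurable_funB => //; exact: measurable_funM.
Qed.

Lemma normal_pdf_lik1 (t x : R) :
  normal_pdf t 1 x = (lik1 t x * normal_pdf 0 1 x)%R.
Proof.
rewrite !normal_pdfE ?oner_neq0// mulrCA /normal_fun /lik1 -expRD.
by congr (_ * expR _)%R; field.
Qed.

Lemma ge0_integral_normal_shift (t : R) (f : measurableTypeR R -> \bar R) :
  measurable_fun setT f -> (forall x, 0 <= f x) ->
  \int[normal_prob t 1]_x f x = \int[normal_prob 0 1]_x ((lik1 t x)%:E * f x).
Proof.
move=> mf f0; rewrite (ge0_integral_normal_prob t 1 mf f0).
rewrite [RHS]ge0_integral_normal_prob.
- apply: eq_integral => x _.
  by rewrite normal_pdf_lik1 EFinM muleA [f x * _]muleC.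
- by apply: emeasurable_funM => //; apply/measurable_EFinP; exact: measurable_lik1.
- by move=> x; rewrite mule_ge0// lee_fin expR_ge0.
Qed.

Lemma measurable_consl d (T : measurableType d) n (x : T) :
  measurable_fun setT (fun y : n.-tuple T => [tuple of x :: y]).
Proof. by apply: measurable_cons. Qed.

Lemma ge0_integral_prod_prob d (T : measurableType d) n
    (P : 'I_n.+1 -> probability T R) (f : n.+1.-tuple T -> \bar R) :
  measurable_fun setT f -> (forall y, 0 <= f y) ->
  \int[prod_prob P]_y f y =
  \int[P ord0]_x \int[prod_prob (fun i => P (lift ord0 i))]_y f [tuple of x :: y].
Proof.
move=> mf f0 /=.
rewrite ge0_integral_pushforward// preimage_setT fubini_tonelli1//.
  by apply: measurableT_comp => //; exact: measurable_tuple_cons.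
by move=> x /=.
Qed.

Lemma measurable_integral_cons d (T : measurableType d) n
    (P : probability (n.-tuple T) R) (f : n.+1.-tuple T -> \bar R) :
  measurable_fun setT f -> (forall y, 0 <= f y) ->
  measurable_fun setT (fun x => \int[P]_y f [tuple of x :: y]).
Proof.
move=> mf f0.
apply: (measurable_fun_fubini_tonelli_F (m2 := P) (f \o @tuple_cons _ T n)) => //.
  by apply: measurableT_comp => //; exact: measurable_tuple_cons.
by move=> x /=.
Qed.

Lemma measurable_prod_tnth d (T : measurableType d) n (l : 'I_n -> T -> R) :
  (forall i, measurable_fun setT (l i)) ->
  measurable_fun setT (fun y : n.-tuple T => \prod_(i < n) l i (tnth y i))%R.
Proof.
move=> ml; apply: measurable_prod => i _; apply: (measurableT_comp (ml i)).
exact: measurable_tnth.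
Qed.

(** Tonelli peels off the first coordinate, which leaves the one-dimensional hypothesis and the
    induction hypothesis. *)
Lemma ge0_integral_prod_prob_density d (T : measurableType d) n
    (P Q : 'I_n -> probability T R) (l : 'I_n -> T -> R) :
  (forall i, measurable_fun setT (l i)) -> (forall i x, 0 <= l i x)%R ->
  (forall i (f : T -> \bar R), measurable_fun setT f -> (forall x, 0 <= f x) ->
    \int[P i]_x f x = \int[Q i]_x ((l i x)%:E * f x)) ->
  forall f : n.-tuple T -> \bar R, measurable_fun setT f -> (forall y, 0 <= f y) ->
  \int[prod_prob P]_y f y =
  \int[prod_prob Q]_y ((\prod_(i < n) l i (tnth y i))%:E * f y).
Proof.
elim: n P Q l => [|n IH] P Q l ml l0 PQ f mf f0.
  by congr (\int[_]_y _); apply/funext => y; rewrite big_ord0 mul1e.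
have mlf : measurable_fun setT
    (fun y : n.+1.-tuple T => (\prod_(i < n.+1) l i (tnth y i))%:E * f y).
  by apply: emeasurable_funM => //; apply/measurable_EFinP; exact: measurable_prod_tnth.
have lf0 y : 0 <= (\prod_(i < n.+1) l i (tnth y i))%:E * f y.
  by rewrite mule_ge0// lee_fin prodr_ge0.
rewrite (ge0_integral_prod_prob P mf f0) (ge0_integral_prod_prob Q mlf lf0).
rewrite PQ; last 2 first.
- exact: measurable_integral_cons.
- by move=> x; exact: integral_ge0.
apply: eq_integral => x _.
have mfx : measurable_fun setT (fun y : n.-tuple T => f [tuple of x :: y]).
  by apply: measurableT_comp => //; exact: measurable_consl.
rewrite (IH _ (fun i => Q (lift ord0 i)) (fun i => l (lift ord0 i)))//; last first.
  by move=> i g mg g0; rewrite PQ.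
rewrite -ge0_integralZl//; last 3 first.
- apply: emeasurable_funM => //; apply/measurable_EFinP.
  exact: (measurable_prod_tnth (l := fun i => l (lift ord0 i))).
- by move=> y _; rewrite mule_ge0// lee_fin prodr_ge0.
- by rewrite lee_fin.
apply: eq_integral => y _; rewrite muleA -EFinM; congr (_%:E * _).
rewrite big_ord_recl; congr (_ * _)%R.
by apply: eq_bigr => i _; rewrite tnthS.
Qed.

Definition lik {d} (theta : d.-tuple R) (y : d.-tuple (measurableTypeR R)) : R :=
  (\prod_(i < d) lik1 (tnth theta i) (tnth y i))%R.

Lemma lik_gt0 d (theta : d.-tuple R) y : (0 < lik theta y)%R.
Proof. by apply: prodr_gt0 => i _; exact: expR_gt0. Qed.

Lemma measurable_lik d (theta : d.-tuple R) : measurable_fun setT (lik theta).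
Proof.
by apply: (measurable_prod_tnth (l := fun i => lik1 (tnth theta i))) => i; exact: measurable_lik1.
Qed.

Definition std_normal_law d : probability (d.-tuple (measurableTypeR R)) R :=
  prod_prob (fun=> normal_prob 0 1).

Lemma ge0_integral_normal_law d (theta : d.-tuple R)
    (f : d.-tuple (measurableTypeR R) -> \bar R) :
  measurable_fun setT f -> (forall y, 0 <= f y) ->
  \int[normal_law theta]_y f y = \int[std_normal_law d]_y ((lik theta y)%:E * f y).
Proof.
move=> mf f0; exact: (ge0_integral_prod_prob_density
  (fun i => measurable_lik1 (tnth theta i)) (fun i x => expR_ge0 _)
  (fun i => @ge0_integral_normal_shift (tnth theta i)) mf f0).
Qed.

Lemma integral_lik d (theta : d.-tuple R) :
  \int[std_normal_law d]_y (lik theta y)%:E = 1.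
Proof.
transitivity (\int[normal_law theta]_y cst 1 y).
  by rewrite ge0_integral_normal_law//; apply: eq_integral => y _; rewrite mule1.
by rewrite integral_cst// mul1e; exact: (probability_setT (normal_law theta)).
Qed.

(** Completing the square: the product of the two likelihoods is the exponential of the inner
    product times the likelihood at [theta + theta'], whose integral is 1. *)
Lemma integral_lik_mul d (theta theta' : d.-tuple R) :
  \int[std_normal_law d]_y (lik theta y * lik theta' y)%:E =
  (expR (\sum_(i < d) tnth theta i * tnth theta' i))%:E.
Proof.
pose t := [tuple (tnth theta i + tnth theta' i)%R | i < d].
transitivity (\int[std_normal_law d]_y
  ((expR (\sum_(i < d) tnth theta i * tnth theta' i))%:E * (lik t y)%:E)).
  apply: eq_integral => y _; rewrite -EFinM expR_sum -!big_split/=; congr (_%:E).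
  by apply: eq_bigr => i _; rewrite tnth_mktuple -!expRD; congr expR; field.
rewrite ge0_integralZl//.
- by rewrite integral_lik mule1.
- by apply/measurable_EFinP; exact: measurable_lik.
- by move=> y _; rewrite lee_fin ltW// lik_gt0.
Qed.

End gaussian_likelihood.

(** * Independence of disjoint blocks of coordinates *)

Section independence.
Context d (T : measurableType d) {R : realType}.
Local Open Scope ereal_scope.

Definition depends_on {U : Type} {n} (S : {set 'I_n}) (f : n.-tuple T -> U) :=
  forall y z, (forall i, i \in S -> tnth y i = tnth z i) -> f y = f z.

(** By symmetry the first coordinate may be taken in [S]. Then [g] ignores it, so the inner integral
    of [g] is a constant that leaves the outer integral; the induction hypothesis treats the
    remaining coordinates. *)
Lemma integral_prod_prob_indep n (P : 'I_n -> probability T R) (S : {set 'I_n})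
    (f g : n.-tuple T -> \bar R) :
  measurable_fun setT f -> measurable_fun setT g ->
  (forall y, 0 <= f y) -> (forall y, 0 <= g y) ->
  depends_on S f -> depends_on (~: S) g ->
  \int[prod_prob P]_y (f y * g y) =
  \int[prod_prob P]_y f y * \int[prod_prob P]_y g y.
Proof.
elim: n P S f g => [|n IH] P S f g.
  move=> mf mg f0 g0 _ _; rewrite !integral_dirac//.
    by rewrite diracT !mul1e.
  exact: emeasurable_funM.
wlog S0 : S f g / ord0 \in S => [wl|].
  move=> mf mg f0 g0 Sf Sg; have [/wl|S0] := boolP (ord0 \in S); first exact.
  under eq_integral do rewrite muleC.
  by rewrite [RHS]muleC; apply: (wl (~: S)) => //; rewrite ?inE ?finset.setCK.
move=> mf mg f0 g0 Sf Sg.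
have mfg : measurable_fun setT (fun y => f y * g y) by exact: emeasurable_funM.
have fg0 y : 0 <= f y * g y by rewrite mule_ge0.
rewrite (ge0_integral_prod_prob P mfg fg0) (ge0_integral_prod_prob P mf f0).
rewrite (ge0_integral_prod_prob P mg g0).
set P' := fun i => P (lift ord0 i).
pose S' : {set 'I_n} := finset (fun i => lift ord0 i \in S).
have gE x z (y : n.-tuple T) : g [tuple of x :: y] = g [tuple of z :: y].
  apply: Sg => i; rewrite inE; case: (unliftP ord0 i) => [j|] ->; last by rewrite S0.
  by rewrite !tnthS.
(* [point] is an arbitrary first coordinate; by [gE] its value is immaterial. *)
pose c := \int[prod_prob P']_y g [tuple of point :: y].
have gc x : \int[prod_prob P']_y g [tuple of x :: y] = c.
  by apply: eq_integral => y _; exact: gE.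
have c0 : 0 <= c by exact: integral_ge0.
transitivity (\int[P ord0]_x (\int[prod_prob P']_y f [tuple of x :: y] * c)).
  apply: eq_integral => x _; rewrite -(gc x).
  apply: (IH P' S' (fun y => f [tuple of x :: y])
    (fun y => g [tuple of x :: y])) => //.
  - by apply: measurableT_comp => //; exact: measurable_consl.
  - by apply: measurableT_comp => //; exact: measurable_consl.
  - move=> y z yz; apply: Sf => i iS; case: (unliftP ord0 i) iS => [j|] ->; last by [].
    by move=> jS; rewrite !tnthS; apply: yz; rewrite inE.
  - move=> y z yz; apply: Sg => i iS; case: (unliftP ord0 i) iS => [j|] ->; last by [].
    by rewrite inE => jS; rewrite !tnthS; apply: yz; rewrite !inE.
rewrite ge0_integralZr//.
- congr (_ * _); under [RHS]eq_integral do rewrite gc.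
  by rewrite integral_cst// -[LHS]mule1; congr (_ * _); rewrite -(probability_setT (P ord0)).
- exact: measurable_integral_cons.
- by move=> x _; exact: integral_ge0.
Qed.

Lemma integral_prod_prob_prod n (P : 'I_n -> probability T R) (J : eqType)
    (r : seq J) (S : J -> {set 'I_n}) (f : J -> n.-tuple T -> R) :
  uniq r ->
  (forall j k i, i \in S j -> i \in S k -> j = k) ->
  (forall j, measurable_fun setT (f j)) ->
  (forall j y, 0 <= f j y)%R ->
  (forall j, depends_on (S j) (f j)) ->
  \int[prod_prob P]_y (\prod_(j <- r) f j y)%:E =
  \prod_(j <- r) \int[prod_prob P]_y (f j y)%:E.
Proof.
move=> + dS mf f0 Sf; elim: r => [_|j r IH /= /andP[jr ur]].
  rewrite big_nil; under eq_integral do rewrite big_nil.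
  rewrite integral_cst// mul1e; exact: (probability_setT (prod_prob P)).
rewrite big_cons -IH//; under eq_integral do rewrite big_cons EFinM.
apply: (@integral_prod_prob_indep _ _ (S j)).
- exact/measurable_EFinP.
- by apply/measurable_EFinP; exact: measurable_prod.
- by move=> y; rewrite lee_fin.
- by move=> y; rewrite lee_fin prodr_ge0.
- by move=> y z /Sf ->.
- move=> y z yz; congr (_%:E); rewrite big_seq [RHS]big_seq.
  apply: eq_bigr => k kr; apply: Sf => i iSk; apply: yz.
  rewrite inE; apply/negP => iSj.
  by move: jr; rewrite (dS _ _ _ iSj iSk) kr.
Qed.

End independence.

(** * Constrained risk inequality *)

Lemma measurable_fun_inv_gt0 d (T : measurableType d) {R : realType} (f : T -> R) :
  measurable_fun setT f -> (forall x, 0 < f x) -> measurable_fun setT (fun x => (f x)^-1).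
Proof.
move=> mf f0.
rewrite (_ : (fun x => _) = (@powR R ^~ (-1)) \o f).
  by apply: measurableT_comp => //; exact: measurable_powR.
by apply/funext => x /=; rewrite powR_inv1// ltW.
Qed.

Section constrained_risk.
Context {R : realType} {d : nat} {Omega : finType}.
Variables (theta : Omega -> d.-tuple R) (F : Omega -> R).
Implicit Types W : Omega -> R.

(** For a prior [W], this is the density of the observation with respect to the standard normal
    law. *)
Definition mixture_lik W (y : d.-tuple (measurableTypeR R)) : R :=
  \sum_a W a * lik (theta a) y.

Lemma measurable_mixture_lik W : measurable_fun setT (mixture_lik W).
Proof.
by apply: measurable_sum => a; apply: measurable_funM => //; exact: measurable_lik.
Qed.

(* With q = G1/G0, the left-hand side minus the right-hand side is the sum over a
   of lik (theta a) y times W1 (t - F + lam)^2, W0 (t - F - lam q)^2 and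
   tau W0 (F - m - (lam / tau) (q - 1))^2; the terms in t cancel. *)
Lemma constrained_risk_pointwise W0 W1 (lam tau m t : R) y :
  (forall a, 0 <= W0 a) -> (forall a, 0 <= W1 a) -> 0 < mixture_lik W0 y -> 0 < tau ->
  \sum_a (2 * lam * (W1 a - W0 a) * (F a - m) - tau * (W0 a * (F a - m) ^+ 2)
          + lam ^+ 2 / tau * (2 * W1 a - W0 a) - lam ^+ 2 * W1 a) * lik (theta a) y <=
  \sum_a (W0 a + W1 a) * (lik (theta a) y * (t - F a) ^+ 2)
  + (lam ^+ 2 + lam ^+ 2 / tau) * (mixture_lik W1 y ^+ 2 / mixture_lik W0 y).
Proof.
move=> W0_ge0 W1_ge0 G0 tau0.
set g0 := mixture_lik W0 y in G0 *; set g1 := mixture_lik W1 y; pose q := g1 / g0.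
(* The coefficients [al] and [be] rewrite the divergence term as a combination of [g1] and [g0],
   that is, as a sum over [a], so that the inequality can be checked term by term. *)
pose al := - 2 * lam * (t - m) - 2 * (lam ^+ 2 / tau).
pose be := 2 * lam * q * (t - m) - lam ^+ 2 * q ^+ 2
           - lam ^+ 2 / tau * (q ^+ 2 - 2 * q).
have -> : (lam ^+ 2 + lam ^+ 2 / tau) * (g1 ^+ 2 / g0) = - (al * g1 + be * g0).
  by rewrite /al /be /q; field; rewrite !gt_eqF.
rewrite lerBrDr !mulr_sumr -!big_split/=; apply: ler_sum => a _.
set l := lik (theta a) y; have l0 : 0 < l by exact: lik_gt0.
rewrite -subr_ge0 [leRHS](_ : _ = l * (W1 a * (t - F a + lam) ^+ 2
  + W0 a * (t - F a - lam * q) ^+ 2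
  + tau * W0 a * (F a - m - lam / tau * (q - 1)) ^+ 2)); last first.
  by rewrite /al /be; field; rewrite gt_eqF.
have tW0 : 0 <= tau * W0 a by rewrite mulr_ge0// ltW.
by rewrite mulr_ge0 ?(ltW l0)// !addr_ge0// mulr_ge0 ?sqr_ge0.
Qed.

Local Open Scope ereal_scope.

Lemma integral_mixture_lik W : (forall a, 0 <= W a)%R ->
  \int[std_normal_law d]_y (mixture_lik W y)%:E = (\sum_a W a)%:E.
Proof.
move=> W0; rewrite /mixture_lik.
under eq_integral do rewrite -sumEFin.
rewrite ge0_integral_sum//; last 2 first.
- by move=> a; apply/measurable_EFinP/measurable_funM => //; exact: measurable_lik.
- by move=> a y _; rewrite lee_fin mulr_ge0// ltW// lik_gt0.
rewrite -sumEFin; apply: eq_bigr => a _.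
under eq_integral do rewrite EFinM.
rewrite ge0_integralZl_EFin//; first by rewrite integral_lik mule1.
  by move=> y _; rewrite lee_fin ltW// lik_gt0.
by apply/measurable_EFinP; exact: measurable_lik.
Qed.

Lemma mixture_lik_ge0 W y : (forall a, 0 <= W a)%R -> (0 <= mixture_lik W y)%R.
Proof. by move=> W0; apply: sumr_ge0 => a _; rewrite mulr_ge0// ltW// lik_gt0. Qed.

(** The pointwise inequality with [m = m0] and [t = est y], integrated against the standard normal
    law. The variance under [W0] enters through [tau * V2], the divergence through
    [lam ^+ 2 / tau * I2]; [tau] balances the two. *)
Lemma constrained_risk W0 W1 (Phi : d.-tuple R -> R)
    (est : d.-tuple (measurableTypeR R) -> R) (lam tau m0 m1 V2 I2 rho : R) :
  measurable_fun setT est ->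
  (forall a, 0 <= W0 a)%R -> (forall a, 0 <= W1 a)%R ->
  (\sum_a W0 a = 1)%R -> (\sum_a W1 a = 1)%R ->
  (forall a, Phi (theta a) = F a) ->
  (\sum_a W0 a * F a = m0)%R -> (\sum_a W1 a * F a = m1)%R ->
  (\sum_a W0 a * (F a - m0) ^+ 2 <= V2)%R ->
  (forall y, 0 < mixture_lik W0 y)%R ->
  \int[std_normal_law d]_y (mixture_lik W1 y ^+ 2 / mixture_lik W0 y)%:E <= (1 + I2)%:E ->
  (forall a, mse Phi est (theta a) <= rho%:E) ->
  (0 < tau)%R ->
  (2 * lam * (m1 - m0) - tau * V2 - lam ^+ 2 / tau * I2 - lam ^+ 2 * (2 + I2)
     <= 2 * rho)%R.
Proof.
move=> mest W0_ge0 W1_ge0 sW0 sW1 PhiE m0E m1E V2E G0 chi2 risk tau0.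
pose c a : R := (2 * lam * (W1 a - W0 a) * (F a - m0) - tau * (W0 a * (F a - m0) ^+ 2)
          + lam ^+ 2 / tau * (2 * W1 a - W0 a) - lam ^+ 2 * W1 a)%R.
(* The coefficients [c a] may be negative. Adding [k] to each of them, and the corresponding mixture
   to the other side, leaves only integrals of nonnegative functions; the two additions cancel in
   the end. *)
pose k : R := (\sum_a `|c a|)%R.
have k_ge a : (0 <= c a + k)%R.
  rewrite -lerBlDr sub0r; apply: le_trans (_ : - `|c a| <= _)%R.
    by rewrite lerN2 /k (bigD1 a)//= lerDl sumr_ge0.
  by rewrite lerNl -normrN ler_norm.
have k0 : (0 <= k)%R by apply: sumr_ge0.
have kap0 : (0 <= lam ^+ 2 + lam ^+ 2 / tau)%R.
  by rewrite addr_ge0 ?divr_ge0 ?sqr_ge0// ltW.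
set kap := (lam ^+ 2 + lam ^+ 2 / tau)%R in kap0 *.
have mlik a := measurable_lik (theta a).
have lik0 a y : (0 <= lik (theta a) y)%R by rewrite ltW ?lik_gt0.
pose A y : R := (\sum_a (W0 a + W1 a) * (lik (theta a) y * (est y - F a) ^+ 2))%R.
pose B y : R := (mixture_lik W1 y ^+ 2 / mixture_lik W0 y)%R.
have mA : measurable_fun setT A.
  apply: measurable_sum => a; apply: measurable_funM => //; apply: measurable_funM => //.
  by apply: measurable_funX; exact: measurable_funB.
have mB : measurable_fun setT B.
  apply: measurable_funM; first by apply: measurable_funX; exact: measurable_mixture_lik.
  by apply: measurable_fun_inv_gt0 => //; exact: measurable_mixture_lik.
have A0 y : (0 <= A y)%R.
  by apply: sumr_ge0 => a _; rewrite mulr_ge0 ?addr_ge0// mulr_ge0// sqr_ge0.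
have B0 y : (0 <= B y)%R by rewrite divr_ge0 ?sqr_ge0// ltW.
have le_pw y : (mixture_lik (fun a => c a + k) y <=
    A y + kap * B y + mixture_lik (fun=> k) y)%R.
  rewrite -lerBlDr /mixture_lik -sumrB.
  under eq_bigr do rewrite mulrDl addrK.
  exact: constrained_risk_pointwise.
have intA : \int[std_normal_law d]_y (A y)%:E <= (2 * rho)%:E.
  rewrite /A; under eq_integral do rewrite -sumEFin.
  rewrite ge0_integral_sum//; last 2 first.
  - move=> a; apply/measurable_EFinP; apply: measurable_funM => //; apply: measurable_funM => //.
    by apply: measurable_funX; exact: measurable_funB.
  - by move=> a y _; rewrite lee_fin mulr_ge0 ?addr_ge0// mulr_ge0// sqr_ge0.
  have -> : (2 * rho = \sum_a (W0 a + W1 a) * rho)%R.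
    by rewrite -mulr_suml big_split/= sW0 sW1.
  rewrite -sumEFin; apply: lee_sum => a _.
  under eq_integral do rewrite EFinM.
  have mse_meas : measurable_fun setT (fun y => ((est y - F a) ^+ 2)%:E).
    by apply/measurable_EFinP; apply: measurable_funX; exact: measurable_funB.
  have mse_ge0 y : 0 <= ((est y - F a) ^+ 2)%:E by rewrite lee_fin sqr_ge0.
  rewrite ge0_integralZl_EFin ?addr_ge0//.
  - rewrite EFinM lee_wpmul2l ?lee_fin ?addr_ge0//.
    under eq_integral do rewrite EFinM.
    rewrite -(ge0_integral_normal_law _ mse_meas mse_ge0).
    by have := risk a; rewrite /mse unlock PhiE.
  - by move=> y _; rewrite lee_fin mulr_ge0// sqr_ge0.
  - apply/measurable_EFinP; apply: measurable_funM => //.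
    by apply: measurable_funX; exact: measurable_funB.
have mk W : measurable_fun setT (fun y => (mixture_lik W y)%:E).
  by apply/measurable_EFinP; exact: measurable_mixture_lik.
have : \int[std_normal_law d]_y (mixture_lik (fun a => c a + k) y)%:E <=
    \int[std_normal_law d]_y ((A y)%:E + (kap * B y)%:E + (mixture_lik (fun=> k) y)%:E).
  apply: ge0_le_integral => //.
  - by move=> y _; rewrite lee_fin mixture_lik_ge0.
  - apply: emeasurable_funD => //; apply/measurable_EFinP.
    by apply: measurable_funD => //; exact: measurable_funM.
  - by move=> y _; rewrite -!EFinD lee_fin.
rewrite integral_mixture_lik// ge0_integralD//; last 3 first.
- by move=> y _; rewrite -EFinD lee_fin addr_ge0// mulr_ge0.
- by apply/measurable_EFinP; apply: measurable_funD => //; exact: measurable_funM.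
- by move=> y _; rewrite lee_fin mixture_lik_ge0.
rewrite integral_mixture_lik// ge0_integralD//; last 4 first.
- by move=> y _; rewrite lee_fin.
- exact/measurable_EFinP.
- by move=> y _; rewrite lee_fin mulr_ge0.
- by apply/measurable_EFinP; exact: measurable_funM.
under [X in _ <= _ + X + _ -> _]eq_integral do rewrite EFinM.
rewrite ge0_integralZl_EFin//; last 2 first.
- by move=> y _; rewrite lee_fin.
- exact/measurable_EFinP.
move=> le_int.
have {le_int} : (\sum_a (c a + k))%:E <=
    (2 * rho)%:E + kap%:E * (1 + I2)%:E + (\sum_(a : Omega) k)%:E.
  apply: le_trans le_int _; apply: leeD => //; apply: leeD => //.
  by rewrite lee_wpmul2l ?lee_fin.
rewrite -EFinM -!EFinD lee_fin big_split/= lerD2r.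
have -> : (\sum_a c a = 2 * lam * (m1 - m0)
    - tau * (\sum_a W0 a * (F a - m0) ^+ 2) + lam ^+ 2 / tau - lam ^+ 2)%R.
  transitivity (\sum_a (2 * lam * (W1 a * F a)
      + (- 2 * lam * m0 + 2 * (lam ^+ 2 / tau) - lam ^+ 2) * W1 a
      + (- 2 * lam) * (W0 a * F a) + (2 * lam * m0 - lam ^+ 2 / tau) * W0 a
      + (- tau) * (W0 a * (F a - m0) ^+ 2)))%R.
    by apply: eq_bigr => a _; rewrite /c; field; rewrite gt_eqF.
  by rewrite !big_split/= -!mulr_sumr m1E sW1 m0E sW0; field; rewrite gt_eqF.
have := ler_wpM2l (ltW tau0) V2E.
set V := (tau * \sum_a _)%R => VV H.
rewrite /kap in H; lra.
Qed.

(** For nonnegative weights, this is the L2 inner product of the two mixture densities. Being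
    bilinear, it also makes sense for signed weights such as [W1 - W0]. *)
Definition lik_form W W' : R :=
  (\sum_a \sum_b W a * W' b *
    expR (\sum_j tnth (theta a) j * tnth (theta b) j))%R.

Lemma integral_mixture_lik_mul W W' :
  (forall a, 0 <= W a)%R -> (forall a, 0 <= W' a)%R ->
  \int[std_normal_law d]_y (mixture_lik W y * mixture_lik W' y)%:E =
  (lik_form W W')%:E.
Proof.
move=> W0 W'0.
have mll a b : measurable_fun setT (fun y => (lik (theta a) y * lik (theta b) y)%R).
  by apply: measurable_funM; exact: measurable_lik.
have ll0 a b y : (0 <= lik (theta a) y * lik (theta b) y)%R.
  by rewrite mulr_ge0// ltW// lik_gt0.
transitivity (\int[std_normal_law d]_y (\sum_a \sum_b
    (W a * W' b * (lik (theta a) y * lik (theta b) y))%:E)).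
  apply: eq_integral => y _; under [RHS]eq_bigr do rewrite sumEFin.
  rewrite sumEFin /mixture_lik mulr_suml; congr (_%:E); apply: eq_bigr => a _.
  by rewrite mulr_sumr; apply: eq_bigr => b _; rewrite mulrACA.
rewrite ge0_integral_sum//; last 2 first.
- move=> a; apply: emeasurable_sum => b; apply/measurable_EFinP.
  exact: measurable_funM.
- by move=> a y _; apply: sume_ge0 => b _; rewrite lee_fin !mulr_ge0// ltW// lik_gt0.
rewrite /lik_form -sumEFin; apply: eq_bigr => a _.
rewrite ge0_integral_sum//; last 2 first.
- by move=> b; apply/measurable_EFinP; exact: measurable_funM.
- by move=> b y _; rewrite lee_fin !mulr_ge0// ltW// lik_gt0.
rewrite -sumEFin; apply: eq_bigr => b _.
under eq_integral do rewrite EFinM.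
rewrite ge0_integralZl_EFin ?mulr_ge0//.
- by rewrite integral_lik_mul.
- by move=> y _; rewrite lee_fin.
- exact/measurable_EFinP.
Qed.

(** The chi-square divergence is the integral of [(h1 - h0) ^+ 2 / h0], and [h0 >= 1/2] bounds it by
    twice the squared L2 distance of the densities. *)
Lemma chi2_mixture_lik W0 W1 :
  (forall a, 0 <= W0 a)%R -> (forall a, 0 <= W1 a)%R ->
  (\sum_a W0 a = 1)%R -> (\sum_a W1 a = 1)%R ->
  (forall y, 2^-1 <= mixture_lik W0 y)%R ->
  \int[std_normal_law d]_y (mixture_lik W1 y ^+ 2 / mixture_lik W0 y)%:E <=
  (1 + 2 * lik_form (fun a => W1 a - W0 a) (fun a => W1 a - W0 a))%:E.
Proof.
move=> W0_ge0 W1_ge0 sW0 sW1 G0_ge.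
set h0 := mixture_lik W0 in G0_ge *; set h1 := mixture_lik W1.
have h0_gt0 y : (0 < h0 y)%R by apply: lt_le_trans (G0_ge y).
have h0_ge0 y : (0 <= h0 y)%R by rewrite ltW.
have h1_ge0 y : (0 <= h1 y)%R by exact: mixture_lik_ge0.
have mh0 : measurable_fun setT h0 by exact: measurable_mixture_lik.
have mh1 : measurable_fun setT h1 by exact: measurable_mixture_lik.
have mq : measurable_fun setT (fun y => h1 y ^+ 2 / h0 y)%R.
  by apply: measurable_funM; [exact: measurable_funX|exact: measurable_fun_inv_gt0].
have q_ge0 y : (0 <= h1 y ^+ 2 / h0 y)%R by rewrite divr_ge0 ?sqr_ge0.
have m10 : measurable_fun setT (fun y => h1 y * h0 y)%R by exact: measurable_funM.
have m11 : measurable_fun setT (fun y => h1 y * h1 y)%R by exact: measurable_funM.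
have m00 : measurable_fun setT (fun y => h0 y * h0 y)%R by exact: measurable_funM.
(* This is [(h1 - h0) ^+ 2 / h0 <= 2 * (h1 - h0) ^+ 2] with the negative terms moved across, so that
   both sides are sums of nonnegative functions. *)
have pw y : (h1 y ^+ 2 / h0 y + (h0 y + 4 * (h1 y * h0 y)) <=
    2 * h1 y + (2 * (h1 y * h1 y) + 2 * (h0 y * h0 y)))%R.
  rewrite -subr_ge0 [leRHS](_ : _ =
    (2 - (h0 y)^-1) * (h1 y - h0 y) ^+ 2)%R; last by field; rewrite gt_eqF.
  rewrite mulr_ge0 ?sqr_ge0// subr_ge0 -[leRHS]invrK lef_pV2 ?posrE//.
have intZ (k : R) (f : d.-tuple (measurableTypeR R) -> R) : (0 <= k)%R ->
    measurable_fun setT f -> (forall y, 0 <= f y)%R ->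
    \int[std_normal_law d]_y (k * f y)%:E = k%:E * \int[std_normal_law d]_y (f y)%:E.
  move=> k0 mf f0; under eq_integral do rewrite EFinM.
  rewrite ge0_integralZl_EFin//; first by move=> y _; rewrite lee_fin.
  exact/measurable_EFinP.
have intD (f g : d.-tuple (measurableTypeR R) -> R) :
    measurable_fun setT f -> (forall y, 0 <= f y)%R ->
    measurable_fun setT g -> (forall y, 0 <= g y)%R ->
    \int[std_normal_law d]_y (f y + g y)%:E =
    \int[std_normal_law d]_y (f y)%:E + \int[std_normal_law d]_y (g y)%:E.
  move=> mf f0 mg g0; under eq_integral do rewrite EFinD.
  by rewrite ge0_integralD//; (exact/measurable_EFinP || by move=> y _; rewrite lee_fin).
have : \int[std_normal_law d]_y (h1 y ^+ 2 / h0 y + (h0 y + 4 * (h1 y * h0 y)))%:E <=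
    \int[std_normal_law d]_y (2 * h1 y + (2 * (h1 y * h1 y) + 2 * (h0 y * h0 y)))%:E.
  apply: ge0_le_integral => //.
  - by move=> y _; rewrite lee_fin addr_ge0// addr_ge0// mulr_ge0// mulr_ge0.
  - apply/measurable_EFinP; apply: measurable_funD => //.
    by apply: measurable_funD => //; exact: measurable_funM.
  - apply/measurable_EFinP; apply: measurable_funD; first exact: measurable_funM.
    by apply: measurable_funD => //; exact: measurable_funM.
  - by move=> y _; rewrite lee_fin.
have mZ (k : R) (f : d.-tuple (measurableTypeR R) -> R) : measurable_fun setT f ->
    measurable_fun setT (fun y => k * f y)%R by move=> ?; exact: measurable_funM.
have Z0 (k : R) (f : d.-tuple (measurableTypeR R) -> R) : (0 <= k)%R ->
    (forall y, 0 <= f y)%R -> forall y, (0 <= k * f y)%R.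
  by move=> k0 f0 y; rewrite mulr_ge0.
have p10 y : (0 <= h1 y * h0 y)%R by rewrite mulr_ge0.
have p11 y : (0 <= h1 y * h1 y)%R by rewrite mulr_ge0.
have p00 y : (0 <= h0 y * h0 y)%R by rewrite mulr_ge0.
have k2 : (0 <= 2 :> R)%R by [].
have k4 : (0 <= 4 :> R)%R by [].
have mL : measurable_fun setT (fun y => h0 y + 4 * (h1 y * h0 y))%R.
  by apply: measurable_funD => //; exact: mZ.
have L0 y : (0 <= h0 y + 4 * (h1 y * h0 y))%R by rewrite addr_ge0// mulr_ge0.
have mR : measurable_fun setT (fun y => 2 * (h1 y * h1 y) + 2 * (h0 y * h0 y))%R.
  by apply: measurable_funD; exact: mZ.
have R0 y : (0 <= 2 * (h1 y * h1 y) + 2 * (h0 y * h0 y))%R.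
  by rewrite addr_ge0// mulr_ge0.
have -> : \int[std_normal_law d]_y (h1 y ^+ 2 / h0 y + (h0 y + 4 * (h1 y * h0 y)))%:E =
    \int[std_normal_law d]_y (h1 y ^+ 2 / h0 y)%:E + (\int[std_normal_law d]_y (h0 y)%:E +
    4%:E * \int[std_normal_law d]_y (h1 y * h0 y)%:E).
  apply: (etrans (intD _ _ mq q_ge0 mL L0)); congr (_ + _).
  apply: (etrans (intD _ _ mh0 h0_ge0 (mZ 4%R _ m10) (Z0 _ _ k4 p10))); congr (_ + _).
  exact: intZ.
have -> : \int[std_normal_law d]_y (2 * h1 y + (2 * (h1 y * h1 y) + 2 * (h0 y * h0 y)))%:E =
    2%:E * \int[std_normal_law d]_y (h1 y)%:E +
    (2%:E * \int[std_normal_law d]_y (h1 y * h1 y)%:E +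
     2%:E * \int[std_normal_law d]_y (h0 y * h0 y)%:E).
  apply: (etrans (intD _ _ (mZ 2%R _ mh1) (Z0 _ _ k2 h1_ge0) mR R0)); congr (_ + _).
    exact: intZ.
  apply: (etrans (intD _ _ (mZ 2%R _ m11) (Z0 _ _ k2 p11) (mZ 2%R _ m00) (Z0 _ _ k2 p00))).
  by congr (_ + _); exact: intZ.
rewrite !integral_mixture_lik// !integral_mixture_lik_mul// sW0 sW1.
rewrite -!EFinM -!EFinD -leeBrDr// -EFinB => /le_trans; apply; rewrite lee_fin.
have sym : lik_form W0 W1 = lik_form W1 W0.
  rewrite /lik_form exchange_big/=; apply: eq_bigr => a _; apply: eq_bigr => b _.
  by rewrite [(W0 b * _)%R]mulrC; congr (_ * expR _)%R; apply: eq_bigr => j _; rewrite mulrC.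
have -> : lik_form (fun a => W1 a - W0 a)%R (fun a => W1 a - W0 a)%R =
    (lik_form W1 W1 - lik_form W1 W0 - lik_form W0 W1 + lik_form W0 W0)%R.
  rewrite /lik_form -!sumrB -big_split/=; apply: eq_bigr => a _.
  by rewrite -!sumrB -big_split/=; apply: eq_bigr => b _; ring.
by rewrite sym; lra.
Qed.

End constrained_risk.

(** * Duality for best approximation *)

Section duality.
Context {R : realType} {T : eqType}.
Implicit Types (mu nu : seq (R * T)) (f F : T -> R).

(* A sequence of (weight, point) pairs stands for a finitely supported signed measure. *)
Definition ev mu f : R := \sum_(p <- mu) p.1 * f p.2.
(** Points may be repeated in [mu], so this is an upper bound for the total variation rather than
    its value. *)
Definition tvnorm mu : R := \sum_(p <- mu) `|p.1|.
Definition scale_measure (a : R) mu := [seq (a * p.1, p.2) | p <- mu].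

Lemma ev_scale a mu f : ev (scale_measure a mu) f = a * ev mu f.
Proof. by rewrite /ev big_map mulr_sumr; apply: eq_bigr => p _; rewrite mulrA. Qed.

Lemma tvnorm_scale a mu : tvnorm (scale_measure a mu) = `|a| * tvnorm mu.
Proof. by rewrite /tvnorm big_map mulr_sumr; apply: eq_bigr => p _; rewrite normrM. Qed.

Lemma ev_cat mu nu f : ev (mu ++ nu) f = ev mu f + ev nu f.
Proof. by rewrite /ev big_cat. Qed.

Lemma tvnorm_cat mu nu : tvnorm (mu ++ nu) = tvnorm mu + tvnorm nu.
Proof. by rewrite /tvnorm big_cat. Qed.

Lemma evB mu F f t : ev mu (fun x => F x - t * f x) = ev mu F - t * ev mu f.
Proof.
by rewrite /ev mulr_sumr -sumrB; apply: eq_bigr => p _; rewrite mulrBr mulrCA.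
Qed.

Section annihilators.
Variable X : set T.

Definition annihilator n (g : nat -> T -> R) mu :=
  [/\ forall p, p \in mu -> X p.2, tvnorm mu <= 1 &
      forall i, (i < n)%N -> ev mu (g i) = 0].

Lemma annihilator_scale n g a mu : `|a| <= 1 ->
  annihilator n g mu -> annihilator n g (scale_measure a mu).
Proof.
move=> a1 [muX mu1 mug]; split.
- by move=> _ /mapP[p pmu ->] /=; exact: (muX p).
- by rewrite tvnorm_scale mulr_ile1// sumr_ge0.
- by move=> i ?; rewrite ev_scale mug// mulr0.
Qed.

Lemma annihilator_convex n g a mu nu : 0 <= a <= 1 ->
  annihilator n g mu -> annihilator n g nu ->
  annihilator n g (scale_measure a mu ++ scale_measure (1 - a) nu).
Proof.
move=> /andP[a0 a1] [muX mu1 mug] [nuX nu1 nug]; split.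
- move=> p; rewrite mem_cat => /orP[] /mapP[q qmu ->] /=; [exact: (muX q)|exact: (nuX q)].
- rewrite tvnorm_cat !tvnorm_scale !ger0_norm ?subr_ge0//.
  by rewrite -[leRHS](subrKC a) lerD ?ler_piMr ?subr_ge0.
- by move=> i ?; rewrite ev_cat !ev_scale mug// nug// !mulr0 addr0.
Qed.

Lemma annihilator_bound n g mu f b : (forall x, X x -> `|f x| <= b) -> 0 <= b ->
  annihilator n g mu -> `|ev mu f| <= b.
Proof.
move=> fb b0 [muX mu1 _]; rewrite /ev (le_trans (ler_norm_sum _ _ _))//.
apply: (@le_trans _ _ (tvnorm mu * b)); last by rewrite ler_piMl.
rewrite /tvnorm mulr_suml big_seq [leRHS]big_seq; apply: ler_sum => p pmu.
by rewrite normrM ler_wpM2l// fb//; exact: (muX p).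
Qed.

(** The values of [mu] and [nu] at [g n] have opposite signs, so some convex combination vanishes
    there; on it the terms in [tau] cancel and the common lower bound [e] survives. *)
Lemma annihilator_extend n g mu nu F tau e : 0 <= ev mu (g n) -> ev nu (g n) <= 0 ->
  annihilator n g mu -> annihilator n g nu ->
  e <= ev mu F - tau * ev mu (g n) -> e <= ev nu F - tau * ev nu (g n) ->
  exists mu', annihilator n.+1 g mu' /\ e <= ev mu' F.
Proof.
move=> u0 v0 Amu Anu emu enu; set u := ev mu (g n) in u0 emu; set v := ev nu (g n) in v0 enu.
have [uv|uv] := eqVneq (u - v) 0.
  have u00 : u = 0 by lra.
  exists mu; split; last by move: emu; rewrite u00 mulr0 subr0.
  case: Amu => ? ? mug; split=> // i; rewrite ltnS leq_eqVlt => /orP[/eqP ->//|].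
  exact: mug.
have uv0 : 0 < u - v by rewrite lt_neqAle eq_sym uv; lra.
pose a := - v / (u - v).
have a01 : 0 <= a <= 1.
  apply/andP; split; first by rewrite divr_ge0 ?oppr_ge0// ltW.
  by rewrite ler_pdivrMr// mul1r; lra.
have au : a * u + (1 - a) * v = 0 by rewrite /a; field.
have [a0 a1] := andP a01.
have Aa := annihilator_convex a01 Amu Anu.
exists (scale_measure a mu ++ scale_measure (1 - a) nu); split.
  case: (Aa) => ? ? ag; split=> // i; rewrite ltnS leq_eqVlt => /orP[/eqP ->|].
    by rewrite ev_cat !ev_scale.
  exact: ag.
rewrite ev_cat !ev_scale -subr_ge0 (_ : _ - e = a * (ev mu F - tau * u - e)
  + (1 - a) * (ev nu F - tau * v - e) + tau * (a * u + (1 - a) * v)); last by ring.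
by rewrite au mulr0 addr0 addr_ge0// mulr_ge0 ?subr_ge0.
Qed.

(* Induction on n: the parameter t is the coefficient of the last function.
   The annihilators that are good for F - t g_n and give g_n a nonnegative
   (nonpositive) value survive when t decreases (increases), so near the
   supremum of the former t there is one of each sign, and a convex combination
   of the two also kills g_n. *)
Lemma approximation_duality n (g : nat -> T -> R) F (e e' : R) :
  (forall i, (i < n)%N -> exists b, forall x, X x -> `|g i x| <= b) -> e' < e ->
  (forall c : nat -> R, exists2 x, X x & e <= `|F x - \sum_(i < n) c i * g i x|) ->
  exists mu, annihilator n g mu /\ e' <= ev mu F.
Proof.
elim: n F e e' => [|n IH] F e e' gb ee' approx.
  have [x Xx] := approx (fun=> 0); rewrite big_ord0 subr0 => eFx.
  (* With nothing to annihilate, a signed point mass where [|F|] is at least [e] suffices. *)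
  exists [:: (Num.sg (F x), x)]; split; first split => //.
  - by move=> p; rewrite inE => /eqP ->.
  - by rewrite /tvnorm big_seq1 normr_sg lern1 leq_b1.
  - by rewrite /ev big_seq1 /= -normrEsg; lra.
apply: contrapT => nex.
(* The slack [e2 - e'] pays below for moving the coefficient to the supremum [tau]. *)
pose e2 := (e + e') / 2.
have e2e : e2 < e by rewrite /e2; lra.
have e'e2 : e' < e2 by rewrite /e2; lra.
pose good t mu := annihilator n g mu /\ e2 <= ev mu F - t * ev mu (g n).
have goodP t : exists mu, good t mu.
  have [] := IH (fun x => F x - t * g n x) e e2.
  - by move=> i i_n; apply: gb; rewrite ltnS ltnW.
  - exact: e2e.
  - move=> c; have [x Xx ex] := approx (fun i => if i == n then t else c i).
    exists x => //; move: ex; rewrite big_ord_recr/= eqxx opprD addrCA addrA addrC addrA.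
    rewrite (eq_bigr (fun i : 'I_n => c i * g i x))//; last first.
      by move=> i _; rewrite ltn_eqF.
    by congr (_ <= `| _ |); ring.
  - by move=> mu []; rewrite evB => ? ?; exists mu.
pose P t := exists2 mu, good t mu & 0 <= ev mu (g n).
pose N t := exists2 mu, good t mu & ev mu (g n) <= 0.
have PN t : P t \/ N t.
  by have [mu gmu] := goodP t; have [?|/ltW ?] := leP 0 (ev mu (g n)); [left|right]; exists mu.
have Pdown t t' : t' <= t -> P t -> P t'.
  move=> tt' [mu [Amu emu] mu0]; exists mu => //; split=> //.
  by rewrite (le_trans emu)// lerB// ler_wpM2r.
have notPN t : P t -> N t -> False.
  move=> [mu [Amu emu] mu0] [nu [Anu enu] nu0]; apply: nex.
  apply: (annihilator_extend mu0 nu0 Amu Anu (tau := t)).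
  - exact: le_trans (ltW e'e2) emu.
  - exact: le_trans (ltW e'e2) enu.
(* The coefficient is chosen so that the negated measure attains [e2] exactly. A measure of one sign
   thus yields one of the other sign, so [P] and [N] each hold somewhere. *)
have flip mu : annihilator n g mu -> ev mu (g n) != 0 ->
    good ((e2 + ev mu F) / ev mu (g n)) (scale_measure (-1) mu).
  move=> Amu mu0; split; first by apply: annihilator_scale => //; rewrite normrN1.
  by rewrite !ev_scale -subr_ge0 [leRHS](_ : _ = 0)//; field.
have [mu0 [Amu0 emu0]] := goodP 0.
have exP : exists t, P t.
  have [mu_ge0|mu_lt0] := leP 0 (ev mu0 (g n)); first by exists 0, mu0.
  exists ((e2 + ev mu0 F) / ev mu0 (g n)); exists (scale_measure (-1) mu0).
    by apply: flip => //; rewrite lt_eqF.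
  by rewrite ev_scale mulN1r oppr_ge0 ltW.
have exN : exists t, N t.
  have [mu_le0|mu_gt0] := leP (ev mu0 (g n)) 0; first by exists 0, mu0.
  exists ((e2 + ev mu0 F) / ev mu0 (g n)); exists (scale_measure (-1) mu0).
    by apply: flip => //; rewrite gt_eqF.
  by rewrite ev_scale mulN1r oppr_le0 ltW.
have [t0 Nt0] := exN.
have hsP : has_sup [set t | P t].
  split; first exact: exP.
  exists t0 => t /= Pt; rewrite leNgt; apply/negP => t0t.
  exact: notPN (Pdown _ _ (ltW t0t) Pt) Nt0.
have [b gnb] := gb n (ltnSn n).
(* The maximum with 0 and the added 1 keep [B] positive whatever the sign of [b]. *)
pose B := Num.max b 0 + 1.
have gnB x : X x -> `|g n x| <= B.
  by move=> /gnb /le_trans; apply; rewrite /B; case: (leP b 0); lra.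
have B0 : 0 < B by rewrite /B; case: (leP b 0); lra.
pose tau := sup [set t | P t].
(* Since an annihilator takes a value at most [B] in modulus at [g n], changing the coefficient by
   at most [eta] costs at most [eta * B = e2 - e']. *)
pose eta := (e2 - e') / B.
have eta0 : 0 < eta by rewrite divr_gt0// subr_gt0.
have etaB : eta * B = e2 - e' by rewrite /eta; field; rewrite gt_eqF.
have [t1 /= Pt1 taut1] := sup_adherent eta0 hsP.
have t1tau : t1 <= tau by apply: sup_upper_bound.
have N2 : N (tau + eta).
  case: (PN (tau + eta)) => // Pt; exfalso.
  by have : tau + eta <= tau by [apply: sup_upper_bound]; lra.
case: Pt1 => mu [Amu emu] mu_ge0; case: N2 => nu [Anu enu] nu_le0.
have muB := annihilator_bound gnB (ltW B0) Amu; have nuB := annihilator_bound gnB (ltW B0) Anu.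
rewrite ger0_norm// in muB; rewrite ler0_norm// in nuB.
apply: nex; apply: (annihilator_extend mu_ge0 nu_le0 Amu Anu (tau := tau)).
- have : (tau - t1) * ev mu (g n) <= eta * B.
    by apply: ler_pM => //; rewrite ?subr_ge0//; rewrite -/tau in taut1; lra.
  by move: emu; rewrite etaB; lra.
- have : eta * - ev nu (g n) <= eta * B by rewrite ler_wpM2l// ltW.
  by move: enu; rewrite etaB; lra.
Qed.

End annihilators.

End duality.

(** The dual measure has total mass 0, so its positive and negative parts have equal mass [s / 2].
    Normalised, they become [p1] and [p0], and [p1 - p0] is [2 / s] times the measure, where
    [s <= 1]; hence the factor 2 in the gap. *)
Lemma moment_matching {R : realType} (M e e' : R) n (F : R -> R) :
  (0 < n)%N -> 0 < M -> 0 < e' -> e' < e ->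
  (forall p : {poly R}, (size p <= n)%N -> exists2 x, `|x| <= M & e <= `|F x - p.[x]|) ->
  exists (N : nat) (x p0 p1 : 'I_N -> R),
    [/\ forall k, `|x k| <= M,
        (forall k, 0 <= p0 k) /\ (forall k, 0 <= p1 k),
        \sum_k p0 k = 1 /\ \sum_k p1 k = 1,
        forall i, (i < n)%N -> \sum_k (p1 k - p0 k) * x k ^+ i = 0 &
        2 * e' <= \sum_k (p1 k - p0 k) * F (x k)].
Proof.
move=> n0 M0 e'0 ee' approx.
have [||mu [[muM mu1 mug] evF]] := @approximation_duality R R [set x | `|x| <= M] n
    (fun i x => x ^+ i) F e e' _ ee'.
- move=> i _; exists (M ^+ i) => x /= xM; rewrite normrX.
  by rewrite lerXn2r ?nnegrE// ltW.
- move=> c; have [x xM ex] := approx (\poly_(i < n) c i) (size_poly _ _).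
  by exists x => //; rewrite -horner_poly.
pose z := tnth (in_tuple mu).
pose s := tvnorm mu.
have evE f : ev mu f = \sum_k (z k).1 * f (z k).2 by rewrite /ev big_tnth.
have sE : s = \sum_k `|(z k).1| by rewrite /s /tvnorm big_tnth.
have s0 : 0 < s.
  rewrite lt_neqAle eq_sym (sumr_ge0 _ (fun _ _ => normr_ge0 _)) andbT.
  apply/negP => /eqP s0; move: evF; rewrite evE big1 ?leNgt ?e'0// => k _.
  have /(_ k isT)/eqP := psumr_eq0P (fun i _ => normr_ge0 (z i).1) (etrans (esym sE) s0).
  by rewrite normr_eq0 => /eqP ->; rewrite mul0r.
(* Annihilation of the power 0, available because [n] is positive, says that the total mass
   vanishes. *)
have w0 : \sum_k (z k).1 = 0.
  by rewrite -[RHS](mug 0%N n0) evE; apply: eq_bigr => k _; rewrite expr0 mulr1.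
exists (size mu), (fun k => (z k).2), (fun k => (`|(z k).1| - (z k).1) / s),
  (fun k => (`|(z k).1| + (z k).1) / s).
have dE k : (`|(z k).1| + (z k).1) / s - (`|(z k).1| - (z k).1) / s = 2 / s * (z k).1.
  by field; rewrite gt_eqF.
split.
- by move=> k; apply: muM; exact: mem_tnth.
- split=> k; rewrite divr_ge0 ?(ltW s0)// ?subr_ge0 ?ler_norm//.
  by rewrite -lerBlDr sub0r -normrN ler_norm.
- split; rewrite -mulr_suml ?sumrB ?big_split/= w0 ?subr0 ?addr0 -sE divff// gt_eqF//.
- move=> i i_n; under eq_bigr do rewrite dE -(mulrA (2 / s)).
  by rewrite -mulr_sumr -(evE (fun x => x ^+ i)) mug// mulr0.
- under eq_bigr do rewrite dE -(mulrA (2 / s)).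
  rewrite -mulr_sumr -(evE F) mulrAC ler_pdivlMr// -mulrA ler_pM2l//.
  by rewrite (le_trans _ evF)// ler_piMr// ltW.
Qed.

(** * Remainder of the exponential series *)

Section exponential_bounds.
Context {R : realType}.
Implicit Types (t b x L : R).

Lemma exp_coeff_ge0 b n : 0 <= b -> 0 <= exp_coeff b n.
Proof. by move=> b0; rewrite /exp_coeff/= divr_ge0 ?exprn_ge0. Qed.

Lemma series_exp_coeff_le b n : 0 <= b -> series (exp_coeff b) n <= expR b.
Proof.
move=> b0; apply: nondecreasing_cvgn_le; last exact: is_cvg_series_exp_coeff.
by apply/nondecreasing_seqP => m; rewrite !seriesEnat/= big_nat_recr//= lerDl exp_coeff_ge0.
Qed.

(** As [n! j! <= (n + j)!], the term of index [n + j] is at most [b ^+ n / n!] times the term of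
    index [j] in the series of [expR b]. *)
Lemma expR_taylor_remainder t b n : `|t| <= b ->
  `|expR t - series (exp_coeff t) n| <= expR b * (b ^+ n / n`!%:R).
Proof.
move=> tb; have b0 : 0 <= b by exact: le_trans tb.
have cvge : (fun N => `|series (exp_coeff t) (n + N)%N - series (exp_coeff t) n|) @ \oo
    --> `|expR t - series (exp_coeff t) n|.
  apply: cvg_norm; apply: cvgB; last exact: cvg_cst.
  rewrite (_ : (fun N => _) = (fun N => series (exp_coeff t) (N + n)%N)).
    by rewrite (cvg_shiftn n); exact: is_cvg_series_exp_coeff.
  by apply/funext => N; rewrite addnC.
rewrite -(cvg_lim _ cvge)//; apply: limr_le; first by apply/cvg_ex; eexists; exact: cvge.
near=> N; rewrite !seriesEnat/= (big_cat_nat (n := n))//= ?leq_addr//.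
rewrite addrAC subrr add0r (le_trans (ler_norm_sum _ _ _))//.
rewrite -{1}(add0n n) (addnC n) big_addn addnK.
apply: (@le_trans _ _ (series (exp_coeff b) N * (b ^+ n / n`!%:R))); last first.
  by rewrite ler_wpM2r ?series_exp_coeff_le// divr_ge0 ?exprn_ge0.
rewrite seriesEnat/= mulr_suml; apply: ler_sum => j _.
rewrite /exp_coeff/= normrM normrX normfV (ger0_norm (ler0n _ _)).
rewrite exprD mulrACA; apply: ler_pM.
- by rewrite mulr_ge0 ?exprn_ge0.
- by rewrite invr_ge0.
- by rewrite ler_pM ?exprn_ge0// lerXn2r ?nnegrE.
- rewrite -invfM lef_pV2 ?posrE ?mulr_gt0 ?ltr0n ?fact_gt0// -natrM ler_nat.
  by rewrite mulnC -(bin_fact (leq_addl j n)) addnK leq_pmull// bin_gt0 leq_addl.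
Unshelve. all: by end_near. Qed.

Lemma exprn_fact_le_expR x n : 0 <= x -> x ^+ n / n`!%:R <= expR x.
Proof.
case: n => [|n] x0; first by rewrite expr0 divr1 -[leLHS]addr0 (le_trans _ (expR_ge1Dx x))// lerD2l.
by rewrite (le_trans _ (expR_ge1Dxn n x0))// lerDr.
Qed.

(** Obtained from [(1 + 1/8) ^+ 8]; precise enough for [e * (e - 1) >= 4], which produces the
    exponent in [exprn_fact_small]. *)
Lemma expR1_lb : 2565 / 1000 <= expR 1 :> R.
Proof.
have -> : 1 = 8%:R * 8^-1 :> R by rewrite mulfV.
rewrite expRM_natl (@le_trans _ _ ((1 + 8^-1) ^+ 8))//; first by lra.
by rewrite lerXn2r ?nnegrE ?expR_ge0 ?expR_ge1Dx// addr_ge0.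
Qed.

Lemma ln_le_div_expR1 (u : R) : 0 < u -> ln u <= u / expR 1.
Proof.
move=> u0; have := expR_ge1Dx (ln u - 1).
rewrite expRB lnK ?posrE//; lra.
Qed.

(* The factorial is bounded through y^n / n! <= exp y at y = K: with
   u = ln (e L / M2), this gives the exponent K - K (1 + u - ln u), and
   ln u <= u / e makes it at most - (e^2 - e) L. *)
Lemma exprn_fact_small L (M2 : R) n : 0 < M2 -> M2 <= L ->
  expR 1 ^+ 2 * L / ln (expR 1 * L / M2) <= n%:R ->
  M2 ^+ n / n`!%:R <= expR (- 4 * L).
Proof.
move=> M20 M2L; have L0 : 0 < L by exact: lt_le_trans M2L.
set e := expR 1; set u := ln _; set K := _ / u => Kn.
have e_gt0 : 0 < e by exact: expR_gt0.
have u1 : 1 <= u.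
  rewrite /u -(expRK (1 : R)) ler_ln ?posrE ?expR_gt0 ?divr_gt0 ?mulr_gt0//.
  by rewrite ler_pdivlMr// ler_pM2l.
have u0 : 0 < u by lra.
have K0 : 0 < K by rewrite divr_gt0// mulr_gt0// exprn_gt0.
have lnKM : ln (K / M2) = 1 + u - ln u.
  have M2i : 0 < M2^-1 by rewrite invr_gt0.
  have -> : K / M2 = e * (e * L / M2) / u by rewrite /K; field; rewrite !gt_eqF.
  rewrite ln_div ?posrE ?mulr_gt0 ?divr_gt0 ?mulr_gt0//.
  by rewrite lnM ?posrE ?mulr_gt0 ?invr_gt0// /e expRK.
have lnu := ln_le_div_expR1 u0; rewrite -/e in lnu.
have e_lb := expR1_lb; rewrite -/e in e_lb.
have e1 : 1 <= e by apply: le_trans e_lb; lra.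
have ue : u / e <= u by rewrite ler_pdivrMr// ler_peMr// ltW.
have -> : M2 ^+ n / n`!%:R = (M2 / K) ^+ n * (K ^+ n / n`!%:R).
  by rewrite expr_div_n; field; rewrite pnatr_eq0 -lt0n fact_gt0 expf_neq0// gt_eqF.
have -> : (M2 / K) ^+ n = expR (- (n%:R * ln (K / M2))).
  have KM0 : 0 < K / M2 by exact: divr_gt0.
  by rewrite -mulrN expRM_natl expRN lnK ?posrE// [in RHS]invf_div.
apply: (@le_trans _ _ (expR (- (n%:R * ln (K / M2))) * expR K)).
  by rewrite ler_wpM2l ?expR_ge0// exprn_fact_le_expR// ltW.
rewrite -expRD ler_expR.
have : K * ln (K / M2) <= n%:R * ln (K / M2) by rewrite ler_wpM2r// lnKM; lra.
suff : 4 * L <= K * (ln (K / M2) - 1) by lra.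
rewrite lnKM; apply: (@le_trans _ _ (K * (u - u / e))); last first.
  by rewrite ler_wpM2l ?(ltW K0)//; lra.
have -> : K * (u - u / e) = e * (e - 1) * L by rewrite /K; field; rewrite !gt_eqF.
by rewrite ler_pM2r//; nra.
Qed.

(** In the power series of the exponential, the term of degree [i] contributes the square of the
    [i]-th moment of [q] over [i!], which is 0 for [i < n]. Only the Taylor remainder is left. *)
Lemma exp_form_small N (x q : 'I_N -> R) n L M S : 0 < M -> M ^+ 2 <= L ->
  expR 1 ^+ 2 * L / ln (expR 1 * L / M ^+ 2) <= n%:R ->
  (forall k, `|x k| <= M) ->
  (forall i, (i < n)%N -> \sum_k q k * x k ^+ i = 0) ->
  \sum_k `|q k| <= S ->
  \sum_k \sum_j q k * q j * expR (x k * x j) <= S ^+ 2 * expR (- 3 * L).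
Proof.
move=> M0 ML Kn xM mom qS.
pose rem k j := expR (x k * x j) - series (exp_coeff (x k * x j)) n.
have remE k j : `|rem k j| <= expR (- 3 * L).
  have xx : `|x k * x j| <= M ^+ 2 by rewrite normrM ler_pM.
  apply: le_trans (expR_taylor_remainder n xx) _.
  (* The prefactor of the remainder is at most [expR L], which uses up one of the four units of [L]
     in the exponent. *)
  have -> : - 3 * L = L + - 4 * L by ring.
  rewrite expRD ler_pM ?expR_ge0 ?ler_expR//.
    by rewrite divr_ge0 ?exprn_ge0// ltW.
  by apply: exprn_fact_small => //; rewrite exprn_gt0.
have poly0 : \sum_k \sum_j q k * q j * series (exp_coeff (x k * x j)) n = 0.
  transitivity (\sum_(0 <= i < n) (\sum_k q k * x k ^+ i) ^+ 2 / i`!%:R).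
    under eq_bigr => k _ do under eq_bigr => j _ do rewrite seriesEnat/= mulr_sumr.
    under eq_bigr do rewrite exchange_big/=.
    rewrite exchange_big/=; apply: eq_bigr => i _.
    rewrite expr2 mulr_suml mulr_suml; apply: eq_bigr => k _.
    rewrite mulr_sumr mulr_suml; apply: eq_bigr => j _.
    by rewrite /exp_coeff/= exprMn; ring.
  by rewrite big_nat big1// => i /andP[_ i_n]; rewrite mom// expr0n/= mul0r.
have -> : \sum_k \sum_j q k * q j * expR (x k * x j) = \sum_k \sum_j q k * q j * rem k j.
  rewrite -[LHS]subr0 -[X in _ - X]poly0 -sumrB; apply: eq_bigr => k _.
  by rewrite -sumrB; apply: eq_bigr => j _; rewrite -mulrBr.
apply: (@le_trans _ _ ((\sum_k `|q k|) ^+ 2 * expR (- 3 * L))); last first.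
  by rewrite ler_wpM2r ?expR_ge0// lerXn2r ?nnegrE// ?sumr_ge0// (le_trans _ qS)// sumr_ge0.
rewrite expr2 !mulr_suml; apply: ler_sum => k _.
rewrite mulr_sumr mulr_suml; apply: ler_sum => j _.
by rewrite (le_trans (ler_norm _))// !normrM ler_wpM2l// mulr_ge0.
Qed.

End exponential_bounds.

(** * Block priors *)

Section product_weights.
Context {R : realType} {I A : finType} (w : A -> R).
Hypothesis w1 : \sum_c w c = 1.

Definition product_weight (a : {ffun I -> A}) : R := \prod_b w (a b).

Lemma product_weight_ge0 a : (forall c, 0 <= w c) -> 0 <= product_weight a.
Proof. by move=> w0; exact: prodr_ge0. Qed.

Lemma sum_product_weight : \sum_a product_weight a = 1.
Proof. by rewrite -(bigA_distr_bigA (fun _ : I => w)) big1. Qed.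

Lemma product_weight_marginal b0 (f : A -> R) :
  \sum_a product_weight a * f (a b0) = \sum_c w c * f c.
Proof.
transitivity (\sum_(a : {ffun I -> A}) \prod_b (w (a b) * (if b == b0 then f (a b) else 1))).
  by apply: eq_bigr => a _; rewrite big_split/= -big_mkcond big_pred1_eq.
rewrite -(bigA_distr_bigA (fun b c => w c * (if b == b0 then f c else 1))).
rewrite (bigD1 b0)//= eqxx [X in _ * X]big1 ?mulr1// => b /negbTE ->.
by under eq_bigr do rewrite mulr1.
Qed.

Lemma product_weight_marginal2 b0 b1 (f g : A -> R) : b0 != b1 ->
  \sum_a product_weight a * (f (a b0) * g (a b1)) =
  (\sum_c w c * f c) * (\sum_c w c * g c).
Proof.
move=> b01.
transitivity (\sum_(a : {ffun I -> A}) \prod_b (w (a b) *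
    ((if b == b0 then f (a b) else 1) * (if b == b1 then g (a b) else 1)))).
  apply: eq_bigr => a _; rewrite big_split/= big_split/=.
  by rewrite -!big_mkcond !big_pred1_eq.
rewrite -(bigA_distr_bigA (fun b c => w c *
  ((if b == b0 then f c else 1) * (if b == b1 then g c else 1)))).
rewrite (bigD1 b0)//= (bigD1 b1)/=; last by rewrite eq_sym.
rewrite !eqxx (negbTE b01) eq_sym (negbTE b01) mulrA [X in _ * X]big1 ?mulr1; last first.
  by move=> b /andP[/negbTE -> /negbTE ->]; under eq_bigr do rewrite !mulr1.
by congr (_ * _); apply: eq_bigr => c _; rewrite ?mulr1 ?mul1r.
Qed.

Lemma product_weight_mean (f : A -> R) :
  \sum_a product_weight a * (\sum_b f (a b)) = #|I|%:R * \sum_c w c * f c.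
Proof.
under eq_bigr do rewrite mulr_sumr.
rewrite exchange_big/=; under eq_bigr do rewrite product_weight_marginal.
by rewrite sumr_const mulr_natl.
Qed.

(** Distinct blocks are independent and [f] is centred, so the cross terms vanish. *)
Lemma product_weight_variance (f : A -> R) : \sum_c w c * f c = 0 ->
  \sum_a product_weight a * (\sum_b f (a b)) ^+ 2 = #|I|%:R * \sum_c w c * f c ^+ 2.
Proof.
move=> f0.
under eq_bigr do rewrite expr2 mulr_suml mulr_sumr.
rewrite exchange_big/= (eq_bigr (fun=> \sum_c w c * f c ^+ 2)); last first.
  move=> b _; under eq_bigr do rewrite mulr_sumr mulr_sumr.
  rewrite exchange_big/= (bigD1 b)//= [X in _ + X]big1 ?addr0; last first.
    by move=> b' b'b; rewrite product_weight_marginal2 1?eq_sym// f0 mul0r.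
  by rewrite (product_weight_marginal b (fun c => f c * f c)).
by rewrite sumr_const mulr_natl.
Qed.

End product_weights.

Lemma sum_at_most_one {V : nmodType} {I : finType} (t : I -> V) :
  (forall b c, t b != 0 -> t c != 0 -> b = c) ->
  (forall b, t b = 0) \/
  exists b, \sum_c t c = t b /\ forall c, c != b -> t c = 0.
Proof.
move=> t1; have [[b tb]|nt] := pselect (exists b, t b != 0); [right|left].
  have tc c : c != b -> t c = 0.
    by move=> cb; apply/eqP/negPn/negP => tc; move/eqP: cb; apply; exact: t1.
  by exists b; split=> //; rewrite (bigD1 b)//= big1 ?addr0// => c /tc.
by move=> b; apply/eqP/negPn/negP => tb; apply: nt; exists b.
Qed.

(** Applied below to likelihoods, where [lik1 0] is 1 and the operation is the product, and to
    [F t - F 0], where the operation is the sum. *)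
Lemma big_at_most_one {R : Type} {idx : R} {op : Monoid.com_law idx} {V : nmodType}
    {I : finType} (t : I -> V) (f : V -> R) : f 0 = idx ->
  (forall b c, t b != 0 -> t c != 0 -> b = c) ->
  f (\sum_b t b) = \big[op/idx]_b f (t b).
Proof.
move=> f0 /sum_at_most_one[t0|[b [-> tb]]].
  by rewrite !big1// => b _; rewrite t0.
by rewrite [RHS](bigD1 b)//= big1 ?Monoid.mulm1// => c /tb ->.
Qed.

Section block_prior.
Context {R : realType} {d s m N : nat}.
Variables (pos : 'I_s -> 'I_m.+1 -> 'I_d) (x : 'I_N -> R).
Hypothesis pos_inj : forall b b' i i', pos b i = pos b' i' -> b = b' /\ i = i'.

(* A block is empty (inl) or carries the value x k at its i-th place (inr (i, k)). *)
Local Notation state := (unit + ('I_m.+1 * 'I_N))%type.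

Lemma sum_state (f : state -> R) :
  \sum_c f c = f (inl tt) + \sum_i \sum_k f (inr (i, k)).
Proof.
rewrite big_sumType/= (big_pred1 tt); last by case.
by rewrite pair_bigA/=; congr (_ + _); apply: eq_bigr => -[].
Qed.

Definition block_point b (c : state) : d.-tuple R :=
  [tuple (if c is inr u then if j == pos b u.1 then x u.2 else 0 else 0) | j < d].

(** By injectivity of [pos] the blocks occupy disjoint places, so the sum at a coordinate has at
    most one nonzero term. *)
Definition prior_point (a : {ffun 'I_s -> state}) : d.-tuple R :=
  [tuple \sum_b tnth (block_point b (a b)) j | j < d].

Lemma block_point_neq0 b c j : tnth (block_point b c) j != 0 ->
  exists2 u, c = inr u & j = pos b u.1.
Proof.
rewrite tnth_mktuple; case: c => [?|u]; first by rewrite eqxx.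
by case: (j =P pos b u.1) => [->|_]; [exists u|rewrite eqxx].
Qed.

Lemma prior_point_at_most_one (a : {ffun 'I_s -> state}) j b b' :
  tnth (block_point b (a b)) j != 0 -> tnth (block_point b' (a b')) j != 0 -> b = b'.
Proof.
by move=> /block_point_neq0[u _ ->] /block_point_neq0[u' _ /pos_inj[]].
Qed.

Lemma lik_prior_point a y :
  lik (prior_point a) y = \prod_b lik (block_point b (a b)) y.
Proof.
rewrite /lik exchange_big/=; apply: eq_bigr => j _; rewrite tnth_mktuple.
apply: (big_at_most_one (op := *%R) (f := fun t => lik1 t (tnth y j))).
  by rewrite /lik1 mul0r expr0n/= mul0r subr0 expR0.
exact: prior_point_at_most_one.
Qed.

Lemma additive_functional_prior_point (F : R -> R) a :
  additive_functional F (prior_point a) = d%:R * F 0 +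
  \sum_b (if a b is inr u then F (x u.2) - F 0 else 0).
Proof.
have FE j : F (tnth (prior_point a) j) = F 0 +
    \sum_b (F (tnth (block_point b (a b)) j) - F 0).
  rewrite tnth_mktuple -[LHS](subrKC (F 0)); congr (_ + _).
  apply: (big_at_most_one (op := +%R) (f := fun t => F t - F 0)).
    by rewrite subrr.
  exact: prior_point_at_most_one.
rewrite /additive_functional (eq_bigr _ (fun j _ => FE j)) big_split/=.
rewrite sumr_const card_ord mulr_natl exchange_big/=; congr (_ + _).
apply: eq_bigr => b _; case: (a b) => [t|u].
  by rewrite big1// => j _; rewrite tnth_mktuple subrr.
rewrite (bigD1 (pos b u.1))//= tnth_mktuple eqxx big1 ?addr0// => j /negbTE jb.
by rewrite tnth_mktuple jb subrr.
Qed.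

Lemma prior_point_Theta M a : 0 <= M -> (forall k, `|x k| <= M) ->
  prior_point a \in Theta (d := d) s M.
Proof.
move=> M0 xM; rewrite inE; split.
  (* An empty block is sent to an arbitrary place; this makes [g] total, and its image, of size at
     most [s], covers the support. *)
  pose g b := pos b (if a b is inr u then u.1 else ord0).
  rewrite -[leqRHS](card_ord s) /norm0.
  apply: leq_trans (leq_image_card g 'I_s).
  apply: subset_leq_card; apply/fintype.subsetP => j; rewrite inE => j0.
  have [b bj] : exists b, tnth (block_point b (a b)) j != 0.
    apply: contrapT => nb; move: j0; rewrite tnth_mktuple big1 ?eqxx// => b _.
    by apply/eqP/negPn/negP => bj; apply: nb; exists b.
  have [u ab ->] := block_point_neq0 bj.
  by apply/fintype.imageP; exists b => //; rewrite /g ab.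
rewrite /norm_infty; apply: bigmax_le => // j _.
rewrite tnth_mktuple.
have [b0|[b [-> _]]] := sum_at_most_one (@prior_point_at_most_one a j).
  by rewrite big1 ?normr0.
by rewrite tnth_mktuple; case: (a b) => [?|u]; last case: ifP; rewrite ?normr0.
Qed.

(** The empty state has likelihood 1, so its weight 1/2 keeps the block density at least 1/2, as
    [chi2_mixture_lik] requires. *)
Definition block_weight (p : 'I_N -> R) (c : state) : R :=
  if c is inr u then p u.2 / (2 * m.+1%:R) else 2^-1.

Lemma block_weight_ge0 p c : (forall k, 0 <= p k) -> 0 <= block_weight p c.
Proof.
by move=> p0; case: c => [_|u] /=; rewrite ?invr_ge0// divr_ge0// mulr_ge0.
Qed.

Lemma sum_block_weight_mul p (f : 'I_N -> R) :
  \sum_c block_weight p c * (if c is inr u then f u.2 else 0) =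
  2^-1 * \sum_k p k * f k.
Proof.
rewrite sum_state/= mulr0 add0r sumr_const card_ord -[LHS]mulr_natl !mulr_sumr.
by apply: eq_bigr => k _; field; rewrite nat1r pnatr_eq0.
Qed.

Lemma sum_block_weight p : \sum_k p k = 1 -> \sum_c block_weight p c = 1.
Proof.
move=> p1; rewrite sum_state/= sumr_const card_ord -mulr_suml p1 -[X in _ + X]mulr_natl.
by field; rewrite nat1r pnatr_eq0.
Qed.

Local Notation block_mixture b p := (mixture_lik (block_point b) (block_weight p)).

Lemma mixture_prior_point p y :
  mixture_lik prior_point (product_weight (block_weight p)) y =
  \prod_b block_mixture b p y.
Proof.
rewrite /mixture_lik bigA_distr_bigA; apply: eq_bigr => a _.
by rewrite lik_prior_point /product_weight -big_split.
Qed.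

Lemma block_mixture_ge p b y : (forall k, 0 <= p k) -> 2^-1 <= block_mixture b p y.
Proof.
move=> p0; rewrite /mixture_lik sum_state/= [lik _ _](_ : _ = 1).
  rewrite mulr1 lerDl; apply: sumr_ge0 => i _; apply: sumr_ge0 => k _.
  by rewrite mulr_ge0 ?(ltW (lik_gt0 _ _))// divr_ge0// mulr_ge0.
by rewrite /lik big1// => j _; rewrite tnth_mktuple /lik1 mul0r expr0n/= mul0r subr0 expR0.
Qed.

Definition block b : {set 'I_d} := finset (fun j => [exists i, j == pos b i]).

Lemma block_mixture_depends p b : depends_on (block b) (block_mixture b p).
Proof.
move=> y z yz; apply: eq_bigr => c _; congr (_ * _); apply: eq_bigr => j _.
have [->|tj] := eqVneq (tnth (block_point b c) j) 0.
  by rewrite /lik1 !mul0r.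
rewrite yz// inE; have [u _ ->] := block_point_neq0 tj.
by apply/existsP; exists u.1.
Qed.

Lemma block_point_dot b c c' :
  \sum_j tnth (block_point b c) j * tnth (block_point b c') j =
  if c is inr u then if c' is inr v then
    if u.1 == v.1 then x u.2 * x v.2 else 0 else 0 else 0.
Proof.
case: c => [t|u]; first by rewrite big1// => j _; rewrite tnth_mktuple mul0r.
case: c' => [t|v].
  by rewrite big1// => j _; rewrite mulrC tnth_mktuple mul0r.
rewrite (bigD1 (pos b u.1))//= big1 ?addr0; last first.
  by move=> j /negbTE ju; rewrite tnth_mktuple ju mul0r.
rewrite !tnth_mktuple eqxx; case: (u.1 =P v.1) => [->|uv]; first by rewrite eqxx.
by case: eqP => [/pos_inj[_ /uv]|_]//; rewrite mulr0.
Qed.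

(** At two different places the inner product is 0 and the exponential is 1, so these pairs cancel
    because [p1 - p0] has mass 0. Each of the [m.+1] equal places gives the form divided by
    [(2 * m.+1) ^+ 2]. *)
Lemma block_lik_form b (p0 p1 : 'I_N -> R) : \sum_k (p1 k - p0 k) = 0 ->
  lik_form (block_point b) (fun c => block_weight p1 c - block_weight p0 c)
    (fun c => block_weight p1 c - block_weight p0 c) =
  (\sum_k \sum_l (p1 k - p0 k) * (p1 l - p0 l) * expR (x k * x l)) / (4 * m.+1%:R).
Proof.
set q := fun k => p1 k - p0 k => q0.
pose D : R := 2 * m.+1%:R.
have D0 : D != 0 by rewrite mulf_neq0// pnatr_eq0.
pose rho c := block_weight p1 c - block_weight p0 c.
have rho1 t : rho (inl t) = 0 by rewrite /rho subrr.
have rhoE u : rho (inr u) = q u.2 / D by rewrite /rho /= -mulrBl.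
have row i k : \sum_c' rho (inr (i, k)) * rho c' *
      expR (\sum_j tnth (block_point b (inr (i, k))) j * tnth (block_point b c') j) =
    \sum_l q k * q l * expR (x k * x l) / D ^+ 2.
  rewrite sum_state rho1 mulr0 mul0r add0r (bigD1 i)//= [X in _ + X]big1 ?addr0.
    apply: eq_bigr => l _; rewrite block_point_dot/= eqxx !rhoE/=.
    by field.
  move=> i' i'i; transitivity (\sum_l q k / D / D * q l); last first.
    by rewrite -mulr_sumr q0 mulr0.
  apply: eq_bigr => l _; rewrite block_point_dot/= eq_sym (negbTE i'i) expR0 !rhoE/=.
  by field.
rewrite /lik_form -/rho sum_state [X in X + _]big1 ?add0r; last first.
  by move=> c' _; rewrite /= subrr !mul0r.
rewrite (eq_bigr (fun=> \sum_k \sum_l q k * q l * expR (x k * x l) / D ^+ 2)); last first.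
  by move=> i _; apply: eq_bigr => k _; exact: row.
rewrite sumr_const card_ord -[LHS]mulr_natl mulr_suml mulr_sumr; apply: eq_bigr => k _.
rewrite mulr_suml mulr_sumr; apply: eq_bigr => l _.
by rewrite /D /q; field; rewrite nat1r pnatr_eq0.
Qed.

(** The ratio factors over the blocks, which depend on disjoint sets of coordinates, so its integral
    is the product of the block integrals. *)
Lemma chi2_prior (p0 p1 : 'I_N -> R) (kappa : R) :
  (forall k, 0 <= p0 k) -> (forall k, 0 <= p1 k) ->
  \sum_k p0 k = 1 -> \sum_k p1 k = 1 ->
  \sum_k \sum_l (p1 k - p0 k) * (p1 l - p0 l) * expR (x k * x l) <= kappa ->
  (\int[std_normal_law d]_y
     (mixture_lik prior_point (product_weight (block_weight p1)) y ^+ 2 /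
      mixture_lik prior_point (product_weight (block_weight p0)) y)%:E <=
   ((1 + kappa / (2 * m.+1%:R)) ^+ s)%:E)%E.
Proof.
move=> p00 p10 sp0 sp1 kap.
have h_gt0 p b y : (forall k, 0 <= p k) -> 0 < block_mixture b p y.
  by move=> p_ge0; apply: lt_le_trans (block_mixture_ge _ _ _); rewrite ?invr_gt0.
pose f b y := block_mixture b p1 y ^+ 2 / block_mixture b p0 y.
have f0 b y : 0 <= f b y by rewrite divr_ge0 ?sqr_ge0// ltW// h_gt0.
have -> : (\int[std_normal_law d]_y
     (mixture_lik prior_point (product_weight (block_weight p1)) y ^+ 2 /
      mixture_lik prior_point (product_weight (block_weight p0)) y)%:E)%E =
    (\int[std_normal_law d]_y (\prod_b f b y)%:E)%E.
  by apply: eq_integral => y _; rewrite !mixture_prior_point prodf_div prodrXl.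
rewrite /std_normal_law (integral_prod_prob_prod _ (S := block)); last 5 first.
- exact: index_enum_uniq.
- move=> b b' i; rewrite !inE => /existsP[j /eqP ->] /existsP[j' /eqP].
  by move=> /pos_inj[].
- move=> b; apply: measurable_funM.
    by apply: measurable_funX; exact: measurable_mixture_lik.
  apply: measurable_fun_inv_gt0; first exact: measurable_mixture_lik.
  by move=> y; exact: h_gt0.
- exact: f0.
- by move=> b y z yz; rewrite /f !(block_mixture_depends _ yz).
suff H b : (0 <= \int[std_normal_law d]_y (f b y)%:E <= (1 + kappa / (2 * m.+1%:R))%:E)%E.
  rewrite -[in leRHS](card_ord s) -prodr_const.
  have : (0 <= \prod_(b < s) \int[std_normal_law d]_y (f b y)%:E <=
      (\prod_(b < s) (1 + kappa / (2 * m.+1%:R)))%:E)%E.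
    elim/big_ind2: _ => [|X u Y v /andP[X0 Xu] /andP[Y0 Yv]|b _]; last exact: H.
      by rewrite lee01 lexx.
    by rewrite mule_ge0//= EFinM lee_pmul.
  by move=> /andP[].
apply/andP; split; first by apply: integral_ge0 => y _; rewrite lee_fin.
apply: le_trans (chi2_mixture_lik _ _ _ _ _) _.
- by move=> c; exact: block_weight_ge0.
- by move=> c; exact: block_weight_ge0.
- exact: sum_block_weight.
- exact: sum_block_weight.
- by move=> y; exact: block_mixture_ge.
rewrite lee_fin lerD2l block_lik_form; last by rewrite sumrB sp0 sp1 subrr.
rewrite mulrA ler_pdivrMr ?mulr_gt0// [leRHS](_ : _ = 2 * kappa).
  by rewrite ler_pM2l.
by field; rewrite nat1r pnatr_eq0.
Qed.

End block_prior.

(** * Lower bounds *)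

Lemma minimax_risk_ge {R : realType} {d : nat} {Omega : finType}
    (theta : Omega -> d.-tuple R) (F : Omega -> R) (W0 W1 : Omega -> R)
    (Th : set (d.-tuple R)) (Phi : d.-tuple R -> R)
    (lam tau m0 m1 V2 I2 c : R) :
  (forall a, Th (theta a)) ->
  (forall a, 0 <= W0 a) -> (forall a, 0 <= W1 a) ->
  \sum_a W0 a = 1 -> \sum_a W1 a = 1 ->
  (forall a, Phi (theta a) = F a) ->
  \sum_a W0 a * F a = m0 -> \sum_a W1 a * F a = m1 ->
  \sum_a W0 a * (F a - m0) ^+ 2 <= V2 ->
  (forall y, 0 < mixture_lik theta W0 y) ->
  (\int[std_normal_law d]_y (mixture_lik theta W1 y ^+ 2 / mixture_lik theta W0 y)%:E
     <= (1 + I2)%:E)%E ->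
  0 < tau ->
  2 * c <= 2 * lam * (m1 - m0) - tau * V2 - lam ^+ 2 / tau * I2 - lam ^+ 2 * (2 + I2) ->
  (c%:E <= minimax_risk Th Phi)%E.
Proof.
move=> Th_theta W00 W10 sW0 sW1 PhiE m0E m1E V2E G0 chi2 tau0 c_le.
apply/ereal_infP => _ [est _ <-].
have mest : measurable_fun setT est by [].
have risk a : (mse Phi est (theta a) <= ereal_sup [set mse Phi est t | t in Th])%E.
  by apply: ereal_sup_ubound; exists (theta a).
have lb rho := constrained_risk (rho := rho) lam mest W00 W10 sW0 sW1 PhiE m0E
  m1E V2E G0 chi2 ^~ tau0.
case: ereal_sup risk => [rho| |] risk.
- by have := lb _ risk; rewrite lee_fin; lra.
- by rewrite leey.
(* If the supremum were minus infinity, the inequality would hold with [rho = c - 1], contradicting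
   [c_le]. *)
- have : 2 * c <= 2 * (c - 1).
    by apply: le_trans c_le _; apply: lb => a; apply: le_trans (risk a) _; rewrite leNye.
  by move=> ?; exfalso; lra.
Qed.

(** The priors are point masses at 0 and at [x] times the first basis vector. The variance under the
    first is 0 and the divergence is [expR (x ^+ 2) - 1]. *)
Lemma two_point_lower_bound {R : realType} {d : nat} s (M x S : R) (F : R -> R) :
  (0 < s)%N -> (0 < d)%N -> `|x| <= M -> expR (x ^+ 2) <= S ->
  (((F x - F 0) ^+ 2 / (4 * S))%:E <=
   minimax_risk (@Theta R d s M) (additive_functional F (d := d)))%E.
Proof.
case: d => // d' s0 _ xM xS.
have M0 : 0 <= M by exact: le_trans xM.
have S0 : 0 < S by exact: lt_le_trans (expR_gt0 _) xS.
pose theta (b : bool) : d'.+1.-tuple R :=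
  [tuple (if b && (j == ord0) then x else 0) | j < d'.+1].
have thetaE b j : tnth (theta b) j = if b && (j == ord0) then x else 0.
  by rewrite tnth_mktuple.
pose W0 (b : bool) : R := (~~ b)%:R; pose W1 (b : bool) : R := b%:R.
pose D := F x - F 0.
have mixE W y : mixture_lik theta W y =
    W true * lik (theta true) y + W false * lik (theta false) y.
  by rewrite /mixture_lik big_bool.
have lik0 y : lik (theta false) y = 1.
  by rewrite /lik big1// => j _; rewrite thetaE /lik1 mul0r expr0n/= mul0r subr0 expR0.
(* With [tau = 1] the bound reads [2 * lam * D - 2 * S * lam ^+ 2], maximal at
   [lam = D / (2 * S)]. *)
apply: (minimax_risk_ge (theta := theta) (W0 := W0) (W1 := W1) (lam := D / (2 * S))
  (tau := 1) (m0 := d'.+1%:R * F 0) (m1 := d'.+1%:R * F 0 + D) (V2 := 0) (I2 := S - 1)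
  (F := fun b => d'.+1%:R * F 0 + (if b then D else 0))).
- move=> b; split.
    apply: leq_trans s0; rewrite /norm0 -(card1 (ord0 : 'I_d'.+1)).
    apply: subset_leq_card; apply/fintype.subsetP => j; rewrite !inE thetaE.
    by case: (j == ord0) => //; rewrite andbF eqxx.
  by apply: bigmax_le => // j _; rewrite thetaE; case: ifP; rewrite ?normr0.
- by move=> b; rewrite ler0n.
- by move=> b; rewrite ler0n.
- by rewrite big_bool/= add0r.
- by rewrite big_bool/= addr0.
- move=> b; rewrite /additive_functional big_ord_recl thetaE eqxx andbT.
  rewrite (eq_bigr (fun=> F 0)); last by move=> j _; rewrite thetaE andbF.
  rewrite sumr_const card_ord -[X in _ + X = _]mulr_natl -natr1 /D.
  by case: b; ring.
- by rewrite big_bool/= /W0/= mul0r mul1r add0r addr0.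
- by rewrite big_bool/= /W1/= mul0r mul1r addr0.
- by rewrite big_bool/= /W0/= mul0r mul1r add0r addr0 subrr expr0n.
- by move=> y; rewrite mixE /W0/= mul0r add0r mul1r lik0.
- under eq_integral do rewrite !mixE /W0 /W1/= !mul0r add0r addr0 !mul1r lik0 divr1 expr2.
  rewrite integral_lik_mul lee_fin subrKC.
  rewrite big_ord_recl big1 ?addr0; last by move=> j _; rewrite thetaE andbF mul0r.
  by rewrite thetaE/= -expr2.
- by [].
- by rewrite le_eqVlt; apply/orP; left; apply/eqP; rewrite /D; field; rewrite gt_eqF.
Qed.

Lemma expR_le_1D2x {R : realType} (t : R) : 0 <= t <= 2^-1 -> expR t <= 1 + 2 * t.
Proof.
move=> /andP[t0 t1]; have := expR_ge1Dx (- t); rewrite expRN => h.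
have t2 : 0 < 1 - t by lra.
rewrite -[leLHS]invrK (@le_trans _ _ (1 - t)^-1)//.
  by rewrite lef_pV2 ?posrE ?invr_gt0 ?expR_gt0.
by rewrite -[leLHS]mul1r ler_pdivrMr//; nra.
Qed.

(** The constrained risk inequality for the two block priors. The hypothesis with 128 says that the
    variance bound [s B^2] times the divergence bound [8 / r^2] is at most [Delta^2 / 16]. *)
Lemma prior_lower_bound {R : realType} {d s n N : nat} (M B Delta : R) (F : R -> R)
    (x p0 p1 : 'I_N -> R) :
  let r : R := s%:R ^+ 2 / d%:R in
  (0 < s)%N -> (s <= d)%N -> 4 <= r -> 0 < M -> M ^+ 2 <= ln r ->
  expR 1 ^+ 2 * ln r / ln (expR 1 * ln r / M ^+ 2) <= n%:R ->
  (forall k, `|x k| <= M) ->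
  (forall k, 0 <= p0 k) -> (forall k, 0 <= p1 k) ->
  \sum_k p0 k = 1 -> \sum_k p1 k = 1 ->
  (forall i, (i < n)%N -> \sum_k (p1 k - p0 k) * x k ^+ i = 0) ->
  (0 < n)%N ->
  0 < Delta -> Delta <= s%:R * (2^-1 * \sum_k (p1 k - p0 k) * F (x k)) ->
  0 < B -> (forall k, `|F (x k) - F 0| <= B) ->
  128 * (s%:R * B ^+ 2) <= r ^+ 2 * Delta ^+ 2 ->
  ((3 / 32 * Delta ^+ 2)%:E <=
   minimax_risk (@Theta R d s M) (additive_functional F (d := d)))%E.
Proof.
move=> r s0 sd r4 M0 Mr Kn xM p00 p10 sp0 sp1 mom n0 Delta0 DeltaE B0 FB small.
have r0 : 0 < r by lra.
have d0 : (0 < d)%N by exact: leq_trans sd.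
(* Blocks have [m.+1 = d %/ s] places, at least one as [s <= d]; the [d %% s] coordinates left over
   stay at 0. *)
pose m := (d %/ s).-1.
have mE : m.+1 = (d %/ s)%N by rewrite prednK// divn_gt0.
have pos_lt (b : 'I_s) (i : 'I_m.+1) : (b * m.+1 + i < d)%N.
  apply: leq_trans (_ : s * m.+1 <= d)%N; last by rewrite mE mulnC leq_trunc_div.
  apply: leq_trans (_ : b.+1 * m.+1 <= _)%N; last by rewrite leq_mul2r ltn_ord orbT.
  by rewrite mulSn addnC -addSn leq_add2r ltn_ord.
pose pos b i := Ordinal (pos_lt b i).
have pos_inj b b' i i' : pos b i = pos b' i' -> b = b' /\ i = i'.
  move=> /(congr1 val)/= bi.
  have b_b' : b = b' :> nat.
    have /(congr1 (divn^~ m.+1)) := bi.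
    by rewrite !divnMDl// !divn_small ?ltn_ord// !addn0.
  split; apply/val_inj => //.
  by move: bi; rewrite b_b' => /addnI.
pose w (p : 'I_N -> R) := block_weight (m := m) p.
pose W0 := product_weight (I := 'I_s) (w p0); pose W1 := product_weight (I := 'I_s) (w p1).
pose phi (c : unit + 'I_m.+1 * 'I_N) : R := if c is inr u then F (x u.2) - F 0 else 0.
pose mu p : R := \sum_c w p c * phi c.
have muE p : mu p = 2^-1 * \sum_k p k * (F (x k) - F 0).
  by rewrite /mu /phi (sum_block_weight_mul p (fun k => F (x k) - F 0)).
have sw0 : \sum_c w p0 c = 1 by exact: sum_block_weight.
have sw1 : \sum_c w p1 c = 1 by exact: sum_block_weight.
pose Fa (a : {ffun 'I_s -> unit + 'I_m.+1 * 'I_N}) : R := d%:R * F 0 + \sum_b phi (a b).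
have mean p (sw : \sum_c w p c = 1) :
    \sum_a product_weight (w p) a * Fa a = d%:R * F 0 + s%:R * mu p.
  rewrite /Fa; under eq_bigr do rewrite mulrDr.
  rewrite big_split/= -mulr_suml sum_product_weight// mul1r.
  by rewrite product_weight_mean// card_ord.
have x2r : expR (-3 * ln r) = r^-1 ^+ 3.
  by rewrite mulNr expRN expRM_natl lnK// exprVn.
(* The 2 bounds the total mass of [|p1 - p0|], and [expR (- 3 * ln r)] is [r^-1 ^+ 3]. *)
pose kappa : R := 2 ^+ 2 * r^-1 ^+ 3.
have kap : \sum_k \sum_l (p1 k - p0 k) * (p1 l - p0 l) * expR (x k * x l) <= kappa.
  rewrite /kappa -x2r; apply: (exp_form_small M0 Mr Kn xM mom).
  apply: (@le_trans _ _ (\sum_k (p1 k + p0 k))).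
    by apply: ler_sum => k _; rewrite (le_trans (ler_normB _ _))// !ger0_norm.
  by rewrite big_split/= sp0 sp1.
pose I2 : R := 8 / r ^+ 2.
have chi2 : (1 + kappa / (2 * m.+1%:R)) ^+ s <= 1 + I2.
  have m0 : 0 < m.+1%:R :> R by rewrite ltr0n.
  (* Rounding down in [d %/ s] loses at most a factor 2, so [s / m.+1] is at most [2 s^2 / d]. *)
  have sm : s%:R / m.+1%:R <= 2 * r.
    rewrite ler_pdivrMr// /r mulrA mulrAC ler_pdivlMr ?ltr0n//.
    rewrite expr2 -!natrM ler_nat.
    have dsm : (d <= s * (2 * m.+1))%N.
      apply: leq_trans (ltnW (ltn_ceil d s0)) _.
      rewrite -mE mulnC leq_mul2l; apply/orP; right.
      by rewrite mul2n -addnn addSn ltnS leq_addl.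
    have -> : (2 * (s * s) * m.+1 = s * (s * (2 * m.+1)))%N by ring.
    by rewrite leq_mul2l dsm orbT.
  apply: (@le_trans _ _ (expR (kappa / (2 * m.+1%:R)) ^+ s)).
    rewrite lerXn2r ?nnegrE ?expR_ge0 ?expR_ge1Dx//.
    by rewrite addr_ge0// divr_ge0 ?mulr_ge0 ?exprn_ge0 ?invr_ge0// ltW.
  rewrite -expRM_natl.
  have rr : r^-1 ^+ 2 <= 4^-1 ^+ 2.
    by rewrite lerXn2r ?nnegrE ?invr_ge0 ?(ltW r0)// lef_pV2 ?posrE.
  have t_le : s%:R * (kappa / (2 * m.+1%:R)) <= 4 / r ^+ 2.
    have -> : s%:R * (kappa / (2 * m.+1%:R)) = (s%:R / m.+1%:R) * (2 * r^-1 ^+ 3).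
      by rewrite /kappa; field; rewrite !gt_eqF.
    apply: (@le_trans _ _ (2 * r * (2 * r^-1 ^+ 3))).
      by rewrite ler_wpM2r// mulr_ge0// exprn_ge0// invr_ge0 ltW.
    by rewrite le_eqVlt; apply/orP; left; apply/eqP; field; rewrite gt_eqF.
  apply: (@le_trans _ _ (expR (4 / r ^+ 2))); first by rewrite ler_expR.
  have -> : I2 = 2 * (4 / r ^+ 2) by rewrite /I2; field; rewrite gt_eqF.
  apply: expR_le_1D2x; rewrite divr_ge0 ?exprn_ge0 ?(ltW r0)//= -exprVn.
  by lra.
have I2_le1 : I2 <= 1.
  rewrite /I2 ler_pdivrMr ?exprn_gt0// mul1r.
  have r44 : 4 * 4 <= r * r by apply: ler_pM.
  by rewrite expr2; lra.
have I2_ge0 : 0 <= I2 by rewrite divr_ge0// exprn_ge0// ltW.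
pose V2 : R := s%:R * B ^+ 2.
have V0 : 0 < V2 by rewrite mulr_gt0 ?ltr0n// exprn_gt0.
pose D := s%:R * (mu p1 - mu p0).
(* The priors have equal mass, so centring [F] at [F 0] does not change the difference of the
   means. *)
have DE : Delta <= D.
  rewrite /D !muE -mulrBr -sumrB; apply: le_trans DeltaE _.
  rewrite le_eqVlt; apply/orP; left; apply/eqP; congr (_ * (_ * _)).
  transitivity (\sum_k (p1 k - p0 k) * F (x k) - \sum_k (p1 k - p0 k) * x k ^+ 0 * F 0).
    by rewrite -mulr_suml mom// mul0r subr0.
  by rewrite -sumrB; apply: eq_bigr => k _; rewrite expr0; ring.
(* With these [lam] and [tau], the gain is at least [Delta^2 / 2]. The losses are at most 1/16, 1/16
   and 3/16 of [Delta^2], leaving [3/16 Delta^2], twice the claimed bound. *)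
apply: (minimax_risk_ge (theta := prior_point pos x) (F := Fa) (W0 := W0) (W1 := W1)
  (m0 := d%:R * F 0 + s%:R * mu p0) (m1 := d%:R * F 0 + s%:R * mu p1) (V2 := V2)
  (I2 := I2) (lam := Delta / 4) (tau := Delta ^+ 2 / (16 * V2))).
- by move=> a; have := prior_point_Theta pos_inj a (ltW M0) xM; rewrite inE.
- by move=> a; apply: product_weight_ge0 => c; exact: block_weight_ge0.
- by move=> a; apply: product_weight_ge0 => c; exact: block_weight_ge0.
- exact: sum_product_weight.
- exact: sum_product_weight.
- by move=> a; rewrite additive_functional_prior_point.
- exact: mean.
- exact: mean.
- have -> : \sum_a W0 a * (Fa a - (d%:R * F 0 + s%:R * mu p0)) ^+ 2 =
      \sum_a W0 a * (\sum_b (phi (a b) - mu p0)) ^+ 2.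
    apply: eq_bigr => a _; congr (_ * _ ^+ 2).
    by rewrite sumrB sumr_const card_ord -[X in _ = _ - X]mulr_natl /Fa; ring.
  rewrite (product_weight_variance sw0 (f := fun c => phi c - mu p0)); last first.
    by under eq_bigr do rewrite mulrBr; rewrite sumrB -mulr_suml sw0 mul1r subrr.
  rewrite card_ord /V2 ler_wpM2l//.
  apply: (@le_trans _ _ (\sum_c w p0 c * phi c ^+ 2)).
    rewrite -subr_ge0 -sumrB (_ : \sum_c _ = mu p0 ^+ 2) ?sqr_ge0//.
    transitivity (\sum_c (2 * mu p0 * (w p0 c * phi c) - mu p0 ^+ 2 * w p0 c)).
      by apply: eq_bigr => c _; ring.
    by rewrite sumrB -!mulr_sumr sw0 -/(mu p0); ring.
  apply: (@le_trans _ _ (\sum_c w p0 c * B ^+ 2)); last by rewrite -mulr_suml sw0 mul1r.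
  apply: ler_sum => c _; rewrite ler_wpM2l ?block_weight_ge0//.
  have phiB c' : `|phi c'| <= B by case: c' => [_|u] /=; [rewrite normr0 ltW|exact: FB].
  by rewrite -(real_normK (num_real _)) lerXn2r ?nnegrE ?(ltW B0).
- move=> y; rewrite mixture_prior_point//; apply: prodr_gt0 => b _.
  by apply: lt_le_trans (block_mixture_ge _ _ _ _ _); rewrite ?invr_gt0.
- apply: le_trans (chi2_prior pos_inj p00 p10 sp0 sp1 kap) _.
  by rewrite lee_fin.
- by rewrite divr_gt0 ?exprn_gt0// mulr_gt0.
- have -> : d%:R * F 0 + s%:R * mu p1 - (d%:R * F 0 + s%:R * mu p0) = D by rewrite /D; ring.
  have VI : V2 * I2 <= Delta ^+ 2 / 16.
    by rewrite /I2 mulrA ler_pdivrMr ?exprn_gt0//; move: small; rewrite -/V2; lra.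
  have -> : Delta ^+ 2 / (16 * V2) * V2 = Delta ^+ 2 / 16 by field; rewrite gt_eqF.
  have -> : (Delta / 4) ^+ 2 / (Delta ^+ 2 / (16 * V2)) * I2 = V2 * I2.
    by field; rewrite !gt_eqF.
  have : Delta * Delta <= Delta * D by rewrite ler_pM2l.
  have : Delta ^+ 2 * I2 <= Delta ^+ 2 * 1 by rewrite ler_wpM2l ?sqr_ge0.
  by rewrite !expr2 in VI *; lra.
Qed.

(** * Best approximation error and choice of constants *)

Lemma sup_norm_ge {R : realType} (M : R) (g : R -> R) x :
  `|x| <= M -> (`|g x|%:E <= sup_norm M g)%E.
Proof. by move=> xM; apply: ereal_sup_ubound; exists x. Qed.

Lemma best_approx_ge0 {R : realType} (F : R -> R) (K M : R) :
  0 <= M -> (0 <= best_approx F K M)%E.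
Proof.
move=> M0; apply/ereal_infP => _ [p _ <-].
by apply: le_trans (sup_norm_ge _ (_ : `|0| <= M)); rewrite ?lee_fin ?normr0.
Qed.

Lemma best_approx_le_oscillation {R : realType} (F : R -> R) (K M : R) :
  0 <= K -> (best_approx F K M <= sup_norm M (fun x => F x - F 0)%R)%E.
Proof.
move=> K0; apply: ereal_inf_lbound; exists (F 0)%:P.
  by rewrite /polys/= size_polyC; case: (F 0 != 0).
by congr (sup_norm M _); apply/funext => x; rewrite hornerC.
Qed.

Lemma best_approx_lt_witness {R : realType} (F : R -> R) (K M e : R) (p : {poly R}) :
  polys K p -> (e%:E < best_approx F K M)%E ->
  exists2 x, `|x| <= M & e <= `|F x - p.[x]|.
Proof.
move=> Kp e_lt; have : (e%:E < sup_norm M (fun x => F x - p.[x])%R)%E.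
  by apply: lt_le_trans e_lt _; apply: ereal_inf_lbound; exists p.
by move=> /ereal_sup_gt[_ [x xM <-]]; rewrite lte_fin => /ltW; exists x.
Qed.

(** Since [q^2 <= r], one factor [r] absorbs the growth of [B] relative to [D]; the constant [C^2]
    is absorbed by the extra factor [s] by which the squared separation exceeds the variance. *)
Lemma fluctuation_le_separation {R : realType} (s r C B D q : R) :
  1 <= r -> 0 <= s -> 0 <= B -> 0 <= q -> q ^+ 2 <= r -> B <= C * q * D ->
  512 * C ^+ 2 <= s ->
  128 * (s * B ^+ 2) <= r ^+ 2 * (s * (D / 2)) ^+ 2.
Proof.
move=> r1 s0 B0 q0 q2 BD Cs.
have r0 : 0 <= r by exact: le_trans r1.
have B2 : B ^+ 2 <= C ^+ 2 * r * D ^+ 2.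
  apply: (@le_trans _ _ ((C * q * D) ^+ 2)).
    by rewrite lerXn2r ?nnegrE// (le_trans _ BD).
  rewrite [leLHS]exprMn ler_wpM2r ?sqr_ge0// [leLHS]exprMn.
  by rewrite ler_wpM2l ?sqr_ge0.
have BsrD : 512 * B ^+ 2 <= s * r * D ^+ 2.
  apply: (@le_trans _ _ (512 * (C ^+ 2 * r * D ^+ 2))).
    by rewrite ler_wpM2l ?ler0n.
  rewrite (_ : 512 * _ = 512 * C ^+ 2 * r * D ^+ 2); last by ring.
  by rewrite ler_wpM2r ?sqr_ge0// ler_wpM2r.
have rr : r <= r ^+ 2 by rewrite expr2 ler_peMr.
apply: (@le_trans _ _ (r * (s * (D / 2)) ^+ 2)); last by rewrite ler_wpM2r ?sqr_ge0.
rewrite (_ : 128 * _ = s / 4 * (512 * B ^+ 2)); last by field.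
rewrite (_ : r * _ = s / 4 * (s * r * D ^+ 2)); last by field.
by rewrite ler_wpM2l// divr_ge0.
Qed.

Theorem theorem3 (R : realType) :
  exists C : R, 1 <= C /\
  forall C1 C2 : R, 0 < C1 -> 0 < C2 ->
  exists C3 : R, 0 < C3 /\
  forall (d s : nat) (M : R) (F : R -> R) (eps1 eps2 : R),
    let r : R := s%:R ^+ 2 / d%:R in
    let K : R := expR 1 ^+ 2 * ln r / ln (expR 1 * ln r / M ^+ 2) in
    let delta : \bar R := best_approx F K M in
    (0 < s)%N -> (s <= d)%N ->
    C * d%:R <= s%:R ^+ 2 ->
    0 < M -> M <= Num.sqrt (ln r) ->
    {within `[- Num.sqrt (ln r), Num.sqrt (ln r)], continuous F} ->
    0 <= eps1 -> 0 <= eps2 -> 2 * eps1 + 2 * eps2 < 1 ->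
    (sup_norm M (fun x => F x - F 0)%R <= (C1 * r `^ eps1)%:E)%E ->
    (delta^-1 <= (C2 * r `^ eps2)%:E)%E ->
    ((C3 * s%:R ^+ 2)%:E * delta ^+ 2
       <= minimax_risk (@Theta R d s M) (additive_functional F (d:=d)))%E.
Proof.
(* This gives [r >= 4], which keeps [4 / r^2] below 1/2 and [8 / r^2] below 1 in the divergence
   bounds. *)
exists 4; split; first by rewrite ler1n.
move=> C1 C2 C1_gt0 C2_gt0.
(* For s >= S0 the fluctuation is dominated by the separation of the block priors. *)
pose S0 : R := 512 * (C1 * C2) ^+ 2.
have S0_gt0 : 0 < S0 by rewrite mulr_gt0 ?ltr0n ?exprn_gt0 ?mulr_gt0.
(* The first entry is [3/32] times the square of 1/2, for the block priors with separation
   [s D / 2]; the second serves the two-point bound [D^2 / (16 S0)] when [s < S0]. *)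
pose C3 : R := Num.min (3 / 128) (16 * S0 ^+ 3)^-1.
have C3_gt0 : 0 < C3 by rewrite lt_min !divr_gt0//= invr_gt0 mulr_gt0// exprn_gt0.
exists C3; split=> // d s M F eps1 eps2 r K delta s0 sd r_ge M0 Mr _ e10 e20 e12 osc dinv.
have d0 : (0 < d)%N by exact: leq_trans sd.
have r4 : 4 <= r by rewrite ler_pdivlMr ?ltr0n.
have r_gt0 : 0 < r by lra.
have r_s : r <= s%:R.
  by rewrite ler_pdivrMr ?ltr0n// expr2 ler_wpM2l// ler_nat.
have L0 : 0 <= ln r by rewrite ln_ge0//; lra.
have M2r : M ^+ 2 <= ln r.
  by rewrite -[leRHS]sqr_sqrtr// lerXn2r ?nnegrE ?sqrtr_ge0// ltW.
have L_gt0 : 0 < ln r by apply: lt_le_trans M2r; rewrite exprn_gt0.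
have K0 : 0 <= K.
  rewrite divr_ge0 ?mulr_ge0 ?exprn_ge0 ?expR_ge0// ln_ge0//.
  rewrite ler_pdivlMr ?exprn_gt0// mul1r (le_trans M2r)// ler_peMl//.
  by have := expR1_lb (R := R); lra.
have delta_ge0 : (0 <= delta)%E by apply: best_approx_ge0; exact: ltW.
have delta_le : (delta <= (C1 * r `^ eps1)%:E)%E.
  by apply: le_trans osc; exact: best_approx_le_oscillation.
have Kdelta p : polys K p -> forall e, (e%:E < delta)%E ->
    exists2 x, `|x| <= M & e <= `|F x - p.[x]|.
  by move=> Kp e; exact: best_approx_lt_witness.
case: delta delta_ge0 delta_le dinv Kdelta => // D; rewrite !lee_fin => D_ge0 D_le.
(* A zero error would have infinite inverse, against the assumed bound. *)
have [->|D_neq0] := eqVneq D 0; first by rewrite inve0 leye_eq.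
have D0 : 0 < D by rewrite lt_neqAle eq_sym D_neq0.
rewrite inver (negbTE D_neq0) lee_fin => D_inv Kdelta.
pose B := C1 * r `^ eps1.
have B0 : 0 < B by rewrite mulr_gt0// powR_gt0.
have FB x : `|x| <= M -> `|F x - F 0| <= B.
  by move=> xM; rewrite -lee_fin; apply: le_trans osc; exact: (sup_norm_ge (fun x => F x - F 0)).
rewrite -EFin_expe -EFinM.
have [s_lt|s_ge] := ltP (s%:R : R) S0.
  (* Approximating by the constant [F 0] gives a point where [F] differs from [F 0] by at least
     [D / 2], a level strictly below [D]. *)
  have [x xM Dx] : exists2 x, `|x| <= M & D / 2 <= `|F x - F 0|.
    have [||x xM] := Kdelta (F 0)%:P _ (D / 2).
    - by rewrite /polys/= size_polyC; case: (F 0 != 0).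
    - by rewrite lte_fin; lra.
    - by rewrite hornerC; exists x.
  have xS : expR (x ^+ 2) <= S0.
    rewrite (@le_trans _ _ r) ?(ltW (le_lt_trans r_s _))//.
    rewrite -[leRHS]lnK ?posrE// ler_expR (le_trans _ M2r)//.
    by rewrite -(real_normK (num_real x)) lerXn2r ?nnegrE ?(ltW M0).
  apply: le_trans (two_point_lower_bound F s0 d0 xM xS); rewrite lee_fin.
  have Dx2 : D ^+ 2 / 4 <= (F x - F 0) ^+ 2.
    rewrite -[leRHS](real_normK (num_real _)).
    have : (D / 2) ^+ 2 <= `|F x - F 0| ^+ 2 by rewrite lerXn2r ?nnegrE// divr_ge0// ltW.
    by apply: le_trans; lra.
  apply: (@le_trans _ _ ((16 * S0 ^+ 3)^-1 * S0 ^+ 2 * D ^+ 2)).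
    rewrite ler_wpM2r ?sqr_ge0// ler_pM ?(ltW C3_gt0) ?sqr_ge0//.
      by rewrite /C3 ge_min lexx orbT.
    by rewrite lerXn2r ?nnegrE ?(ltW S0_gt0)// ltW.
  have -> : (16 * S0 ^+ 3)^-1 * S0 ^+ 2 * D ^+ 2 = D ^+ 2 / 4 / (4 * S0).
    by field; rewrite gt_eqF.
  by rewrite ler_wpM2r// invr_ge0 mulr_ge0// ltW.
(* Size at most [n] means degree at most the integer part of [K], so such polynomials lie in
   [polys K]; at the same time [K <= n], as the exponential bound needs. *)
pose n := (Num.truncn K).+1.
have [N [x [p0 [p1 [xM [p00 p10] [sp0 sp1] mom sep]]]]] :
    exists (N : nat) (x p0 p1 : 'I_N -> R),
    [/\ forall k, `|x k| <= M,
        (forall k, 0 <= p0 k) /\ (forall k, 0 <= p1 k),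
        \sum_k p0 k = 1 /\ \sum_k p1 k = 1,
        forall i, (i < n)%N -> \sum_k (p1 k - p0 k) * x k ^+ i = 0 &
        2 * (D / 2) <= \sum_k (p1 k - p0 k) * F (x k)].
  (* The level [3/4 D] lies strictly between the gap [D / 2] to be reached and the error [D]; both
     inequalities must be strict. *)
  apply: (@moment_matching _ M (3 / 4 * D)) => //; rewrite ?divr_gt0//; first by lra.
  move=> p pn; apply: Kdelta; last by rewrite lte_fin; lra.
  rewrite /polys/=; have /andP[tK _] := truncn_itv K0.
  by apply: le_trans tK; rewrite ler_nat -ltnS; case: (size p) pn.
have Kn : K <= n%:R by rewrite ltW// truncnS_gt.
have sD0 : 0 < s%:R * (D / 2) by rewrite mulr_gt0 ?ltr0n// divr_gt0.
apply: le_trans (prior_lower_bound s0 sd r4 M0 M2r Kn xM p00 p10 sp0 sp1 mom isT sD0 _ B0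
  (fun k => FB _ (xM k)) _).
- rewrite lee_fin exprMn expr_div_n.
  apply: (@le_trans _ _ (3 / 128 * s%:R ^+ 2 * D ^+ 2)); last by lra.
  by rewrite ler_wpM2r ?sqr_ge0// ler_wpM2r ?sqr_ge0// /C3 ge_min lexx.
- by rewrite ler_wpM2l//; lra.
- pose q := r `^ eps1 * r `^ eps2.
  (* The condition on [eps1] and [eps2] enters here: [q^2] is [r] to the power [2 eps1 + 2 eps2],
     below 1, and [r >= 1]. *)
  have q2 : q ^+ 2 <= r.
    rewrite /q -powRD; last by rewrite (gt_eqF r_gt0) implybT.
    rewrite expr2 -powRD; last by rewrite (gt_eqF r_gt0) implybT.
    rewrite -[leRHS]powRr1 ?(ltW r_gt0)//; by apply: ler_powR; clear -r4 e12; lra.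
  have BD : B <= C1 * C2 * q * D.
    have : B * D^-1 <= C1 * r `^ eps1 * (C2 * r `^ eps2) by rewrite ler_wpM2l// ltW.
    rewrite ler_pdivrMr// => /le_trans; apply.
    by rewrite /q le_eqVlt; apply/orP; left; apply/eqP; ring.
  apply: (fluctuation_le_separation _ _ _ _ q2 BD s_ge); rewrite ?ler0n ?(ltW B0)//.
    by apply: le_trans r4; rewrite ler1n.
  by rewrite mulr_ge0 ?powR_ge0.
Qed.
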